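(* Let $X$ be a GCBA space, let $k$ be a natural number, let $\delta>0$, and let $F:V\to\mathbb R^k$ be a $(k,\delta)$-strainer map on an open subset $V$ of a tiny ball $U$ of $X$. Then the set $V\setminus X_{k+1,12\cdot\delta}$ is a union of a countable family of compact subsets $K_i$ such that each restriction $F:K_i\to F(K_i)$ is biLipschitz.
   Context: A geodesic in a metric space is an isometric embedding of an interval; a local geodesic is a curve whose restriction to a small neighborhood of each parameter is a geodesic. For $\kappa\in\mathbb R$ let $R_\kappa\in(0,\infty]$ be the diameter of the complete simply connected surface $M^2_\kappa$ of constant curvature $\kappa$. A $\mathrm{CAT}(\kappa)$ space is a complete metric space in which any two points at distance $<R_\kappa$ are joined by a geodesic and all geodesic triangles of perimeter $<2R_\kappa$ are not thicker than their comparison triangles in $M^2_\kappa$. A metric space has curvature bounded above by $\kappa$ if every point has a $\mathrm{CAT}(\kappa)$ neighborhood. Such a space is locally geodesically complete if every local geodesic $\gamma:[a,b]\to X$, $a<b$, extends as a local geodesic to a larger interval $[a-\epsilon,b+\epsilon]$, $\epsilon>0$. A GCBA space is a separable, locally compact, locally geodesically complete metric space with curvature bounded above by some $\kappa\in\mathbb R$. The space of directions $\Sigma_x=\Sigma_xX$ is the completion of the set of starting directions of geodesics at $x$ with the angle metric. Tiny balls: in a GCBA space $X$ of curvature $\le\kappa$ an open ball $U=B_{r_0}(x_0)$ is tiny if $r_0\le\min\{1,\frac1{100}R_\kappa\}$ and the closed ball $\bar B_{10r_0}(x_0)$ is compact and $\mathrm{CAT}(\kappa)$. Put $\tilde U=\bar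 B_{5r_0}(x_0)$. For points $x\ne y$ of $\tilde U$, $xy$ is the unique geodesic between them and $(xy)'\in\Sigma_x$ its starting direction. Almost spherical tuples: two points $v,\bar v\in\Sigma_x$ are opposite $\delta$-spherical points if $d(v,w)+d(w,\bar v)<\pi+\delta$ for all $w\in\Sigma_x$. Two $k$-tuples $(v_i),(\bar v_i)$ in $\Sigma_x$ are opposite $\delta$-spherical $k$-tuples if $v_i,\bar v_i$ are opposite $\delta$-spherical points for every $i$, and $d(v_i,\bar v_j)<\frac\pi2+\delta$, $d(v_i,v_j)<\frac\pi2+\delta$, $d(\bar v_i,\bar v_j)<\frac\pi2+\delta$ for all $i\ne j$. A $k$-tuple is $\delta$-spherical if it has an opposite $\delta$-spherical $k$-tuple. A point $x\in X$ is $(k,\delta)$-strained if $\Sigma_xX$ contains a $\delta$-spherical $k$-tuple; $X_{k,\delta}$ is the set of $(k,\delta)$-strained points of $X$. A $k$-tuple $(p_i)$ of points of $\tilde U\setminus\{x\}$ is a $(k,\delta)$-strainer at $x\in U$ if $((xp_i)')$ is a $\delta$-spherical $k$-tuple in $\Sigma_x$. For $V\subset U$, a map $F=(d_{p_1},\dots,d_{p_k}):V\to\mathbb R^k$, where $d_p(x)=d(p,x)$ and $p_i\in\tilde U$, is a $(k,\delta)$-strainer map in $V$ if $(p_i)$ is a $(k,\delta)$-strainer at every point of $V$. *)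

(* Defs.v *)
From HB Require Import structures.
From mathcomp Require Import all_boot all_order all_algebra.
From mathcomp Require Import all_classical all_reals all_analysis.
From mathcomp Require Import ring lra.

Set Implicit Arguments.
Unset Strict Implicit.
Unset Printing Implicit Defensive.

Import Order.TTheory GRing.Theory Num.Theory.
Import numFieldNormedType.Exports.

Local Open Scope classical_set_scope.
Local Open Scope ring_scope.

Definition dot (R : realType) (n : nat) (u v : 'rV[R]_n) : R :=
  \sum_(i < n) u 0 i * v 0 i.

(* The norm of the library on row vectors is the sup norm, hence this one. *)
Definition eucl_dist (R : realType) (n : nat) (u v : 'rV[R]_n) : R :=
  Num.sqrt (dot (u - v) (u - v)).

(* Minus the Lorentz form of signature (2, 1). *)
Definition lorentz (R : realType) (u v : 'rV[R]_3) : R :=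
  u 0 0 * v 0 0 - \sum_(i < 3 | i != 0) u 0 i * v 0 i.

Definition arcosh (R : realType) (t : R) : R := ln (t + Num.sqrt (t ^+ 2 - 1)).

(* The surface M^2_kappa is the unit sphere of R^3, the upper sheet of the
   hyperboloid, or a plane of R^3, with the metric rescaled by
   1 / sqrt |kappa| in the curved cases. *)
Definition model_plane (R : realType) (kappa : R) : set 'rV[R]_3 :=
  if 0 < kappa then [set u | dot u u = 1]
  else if kappa < 0 then [set u | lorentz u u = 1 /\ 0 < u 0 0]
  else [set u | u 0 0 = 0].

Definition model_dist (R : realType) (kappa : R) (u v : 'rV[R]_3) : R :=
  if 0 < kappa then acos (dot u v) / Num.sqrt kappa
  else if kappa < 0 then arcosh (lorentz u v) / Num.sqrt (- kappa)
  else eucl_dist u v.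

Definition model_diam (R : realType) (kappa : R) : \bar R :=
  ereal_sup [set e : \bar R | exists u v, [/\ model_plane kappa u,
    model_plane kappa v & e = (model_dist kappa u v)%:E]].

Section metric_geometry.
Context {R : realType} {X : metricType R}.
Implicit Types (A : set X) (x y z p q r : X) (gamma : R -> X).

(* Curves are total functions on R of which only the restriction to an
   interval is considered. *)
Definition geodesic_on (I : set R) gamma :=
  forall s t, I s -> I t -> mdist (gamma s) (gamma t) = `|s - t|.

Definition local_geodesic_on (I : set R) gamma :=
  forall t, I t -> exists2 e : R, 0 < e &
    geodesic_on (I `&` `]t - e, t + e[%classic) gamma.

Definition geodesic_between x y gamma :=
  [/\ geodesic_on `[0, mdist x y]%classic gamma,
      gamma 0 = x & gamma (mdist x y) = y].

Definition geodesic_within A x y gamma :=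
  geodesic_between x y gamma /\
  (forall t, `[0, mdist x y]%classic t -> A (gamma t)).

(* [complete_on A] and [CAT kappa A] are properties of A with the
   metric induced by X. *)
Definition complete_on A :=
  forall F : set_system X, ProperFilter F -> F A -> cauchy F ->
    exists2 x, A x & F --> x.

(* [x'] is the point of the side [p' q'] of the comparison triangle which
   corresponds to the point [x] of the side [p q]. *)
Definition comparison_point (kappa : R) p q x (p' q' x' : 'rV[R]_3) :=
  [/\ model_plane kappa x', model_dist kappa p' x' = mdist p x
    & model_dist kappa x' q' = mdist x q].

Definition comparison_triangle (kappa : R) p q r (p' q' r' : 'rV[R]_3) :=
  [/\ model_plane kappa p', model_plane kappa q' & model_plane kappa r'] /\
  [/\ model_dist kappa p' q' = mdist p q,
      model_dist kappa q' r' = mdist q r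
    & model_dist kappa r' p' = mdist r p].

(* It is enough to compare points of the sides issuing from the first vertex,
   since the condition is imposed on the triangle with its vertices in any
   order; the comparison triangle exists and is unique up to isometry by the
   bound on the perimeter. *)
Definition thin_triangles (kappa : R) A :=
  forall p q r (pq qr rp : R -> X),
    A p -> A q -> A r ->
    geodesic_within A p q pq -> geodesic_within A q r qr ->
    geodesic_within A r p rp ->
    ((mdist p q + mdist q r + mdist r p)%:E < 2%:E * model_diam kappa)%E ->
  forall s t : R,
    `[0, mdist p q]%classic s -> `[0, mdist r p]%classic t ->
  forall p' q' r' x' y' : 'rV[R]_3,
    comparison_triangle kappa p q r p' q' r' ->
    comparison_point kappa p q (pq s) p' q' x' ->
    comparison_point kappa r p (rp t) r' p' y' ->
    mdist (pq s) (rp t) <= model_dist kappa x' y'.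

Definition CAT (kappa : R) A :=
  [/\ complete_on A,
      (forall x y, A x -> A y -> ((mdist x y)%:E < model_diam kappa)%E ->
         exists gamma, geodesic_within A x y gamma)
    & thin_triangles kappa A].

Definition closed_mball x (r : R) : set X := [set y | mdist x y <= r].

(* The Euclidean comparison angle at [x], by the law of cosines. *)
Definition comparison_angle x y z : R :=
  acos ((mdist x y ^+ 2 + mdist x z ^+ 2 - mdist y z ^+ 2)
          / (2 * mdist x y * mdist x z)).

Record geodesic_from x := GeodesicFrom {
  geo_curve :> R -> X;
  geo_len : R;
  geo_len_gt0 : 0 < geo_len;
  geo_geodesic : geodesic_on `[0, geo_len]%classic geo_curve;
  geo_start : geo_curve 0 = x }.

Definition angle x (g h : geodesic_from x) : R :=
  fine (limf_esup (fun st : R * R => (comparison_angle x (g st.1) (h st.2))%:E)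
          (filter_prod 0^'+ 0^'+)).

(* The space of directions is the completion of the geodesics starting at x
   for the pseudometric [angle]. Its points are given by Cauchy sequences, and
   two of them are the same point when [dir_dist] vanishes; every notion below
   only depends on [dir_dist]. *)
Record directions x := Directions {
  dir_seq :> nat -> geodesic_from x;
  dir_cauchy : forall e : R, 0 < e -> exists N : nat, forall m n : nat,
    (N <= m)%N -> (N <= n)%N -> angle (dir_seq m) (dir_seq n) < e }.

Definition dir_dist x (v w : directions x) : R :=
  limn (fun n => angle (v n) (w n)).

Lemma comparison_angle_geodesic x (g : geodesic_from x) (s t : R) :
  0 < s <= geo_len g -> 0 < t <= geo_len g ->
  comparison_angle x (g s) (g t) = 0.
Proof.
move=> /andP[s0 sl] /andP[t0 tl]; rewrite /comparison_angle.
have I0 : `[0, geo_len g]%classic (0 : R) by rewrite /= in_itv /= lexx ltW// geo_len_gt0.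
have Is : `[0, geo_len g]%classic s by rewrite /= in_itv /= sl ltW.
have It : `[0, geo_len g]%classic t by rewrite /= in_itv /= tl ltW.
have := geo_geodesic I0 Is; rewrite geo_start sub0r normrN gtr0_norm// => ->.
have := geo_geodesic I0 It; rewrite geo_start sub0r normrN gtr0_norm// => ->.
rewrite (geo_geodesic Is It) real_normK ?num_real// sqrrB.
rewrite [X in X / _](_ : _ = 2 * s * t); last first.
  by ring.
by rewrite divff ?acos1// !mulf_neq0// ?gt_eqF.
Qed.

Lemma angle_refl x (g : geodesic_from x) : angle g g = 0.
Proof.
rewrite /angle; set f := (f in limf_esup f _); set F := filter_prod _ _.
pose W : set (R * R) := [set st | 0 < st.1 <= geo_len g /\ 0 < st.2 <= geo_len g].
have right_len : 0^'+ [set s : R | 0 < s <= geo_len g].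
  near=> s; apply/andP; split; first by near: s; exact: nbhs_right_gt.
  by near: s; apply: nbhs_right_le; exact: geo_len_gt0.
have FW : F W.
  by exists ([set s | 0 < s <= geo_len g], [set s | 0 < s <= geo_len g]).
have fW st : W st -> f st = 0%E.
  by case=> ? ?; rewrite /f comparison_angle_geodesic.
rewrite [limf_esup _ _](_ : _ = 0%E)//; apply/eqP; rewrite eq_le; apply/andP; split.
  apply: ge_ereal_inf; exists (ereal_sup (f @` W)); first by exists W.
  by apply: ge_ereal_sup => _ [st Wst <-]; rewrite fW.
apply: le_ereal_inf_tmp => _ [V FV <-].
have [st [Vst Wst]] : (V `&` W) !=set0 by apply: (@filter_ex _ F); exact: filterI.
by apply: ereal_sup_ubound; exists st => //; exact: fW.
Unshelve. all: by end_near. Qed.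

Lemma dir_of_cauchy x (g : geodesic_from x) (e : R) : 0 < e ->
  exists N : nat, forall m n : nat, (N <= m)%N -> (N <= n)%N -> angle g g < e.
Proof. by move=> e0; exists 0%N => *; rewrite angle_refl. Qed.

Definition dir_of x (g : geodesic_from x) : directions x :=
  Directions (dir_seq := fun=> g) (dir_of_cauchy g).

(* [v] is the direction (x y)'. *)
Definition start_dir x y (v : directions x) :=
  exists g : geodesic_from x,
    [/\ geo_len g = mdist x y, g (mdist x y) = y & v = dir_of g].

Definition opposite_spherical_points x (delta : R) (v vb : directions x) :=
  forall w : directions x, dir_dist v w + dir_dist w vb < pi + delta.

Definition opposite_spherical_tuples x (k : nat) (delta : R)
    (v vb : 'I_k -> directions x) :=
  (forall i, opposite_spherical_points delta (v i) (vb i)) /\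
  (forall i j, i != j ->
     [/\ dir_dist (v i) (vb j) < pi / 2 + delta,
         dir_dist (v i) (v j) < pi / 2 + delta
       & dir_dist (vb i) (vb j) < pi / 2 + delta]).

Definition spherical_tuple x (k : nat) (delta : R) (v : 'I_k -> directions x) :=
  exists vb : 'I_k -> directions x, opposite_spherical_tuples delta v vb.

Definition strained (k : nat) (delta : R) : set X :=
  [set x | exists v : 'I_k -> directions x, spherical_tuple delta v].

(* For the tiny balls below the geodesic from x to p i is unique. *)
Definition strainer_at (x0 : X) (r0 : R) (k : nat) (delta : R)
    (p : 'I_k -> X) x :=
  (forall i, closed_mball x0 (5 * r0) (p i) /\ p i <> x) /\
  exists v : 'I_k -> directions x,
    (forall i, start_dir (p i) (v i)) /\ spherical_tuple delta v.

Definition dist_map (k : nat) (p : 'I_k -> X) x : 'rV[R]_k :=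
  \row_(i < k) mdist (p i) x.

(* Only the restriction of [F] to [V] matters. *)
Definition strainer_map (x0 : X) (r0 : R) (k : nat) (delta : R) (V : set X)
    (F : X -> 'rV[R]_k) :=
  exists p : 'I_k -> X,
    [/\ forall i, closed_mball x0 (5 * r0) (p i),
        forall x, V x -> F x = dist_map p x
      & forall x, V x -> strainer_at x0 r0 delta p x].

Definition bilipschitz_on (k : nat) (A : set X) (F : X -> 'rV[R]_k) :=
  exists2 L : R, 0 < L & forall x y, A x -> A y ->
    L^-1 * mdist x y <= eucl_dist (F x) (F y) <= L * mdist x y.

(* [ball x0 r0] is the open ball since X is a [metricType]; [closed_ball] of the
   library is the closure of the open ball, whence [closed_mball]. *)
Definition tiny_ball (kappa : R) (x0 : X) (r0 : R) :=
  [/\ 0 < r0,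
      (r0%:E <= Order.min 1 ((100%:R^-1)%:E * model_diam kappa))%E,
      compact (closed_mball x0 (10 * r0))
    & CAT kappa (closed_mball x0 (10 * r0))].

End metric_geometry.

Section GCBA_spaces.
Context {R : realType} (X : metricType R).

Definition curvature_le (kappa : R) :=
  forall x : X, exists2 A : set X, nbhs x A & CAT kappa A.

Definition locally_geodesically_complete :=
  forall (a b : R) (gamma : R -> X), a < b ->
    local_geodesic_on `[a, b]%classic gamma ->
  exists2 e : R, 0 < e & exists gamma' : R -> X,
    local_geodesic_on `[a - e, b + e]%classic gamma' /\
    (forall t, `[a, b]%classic t -> gamma' t = gamma t).

Definition separable := exists2 D : set X, countable D & dense D.

Definition GCBA :=
  [/\ separable, locally_compact [set: X], locally_geodesically_complete
    & exists kappa : R, curvature_le kappa].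

End GCBA_spaces.

(* Main.v *)
Require Import Defs.
From HB Require Import structures.
From mathcomp Require Import all_boot all_order all_algebra.
From mathcomp Require Import all_classical all_reals all_analysis.
From mathcomp Require Import ring lra.

(* Distance functions on the tiny ball are compared with the three model planes
   at once, through functions [gsin kappa] and [gver kappa] satisfying common
   addition formulas. The comparison yields uniqueness of geodesics, convexity of
   distance functions and the first variation formula: the cosine of the angle at
   [x] between [g] and [h] is the supremum over [t] of
   [(d(x, h s) - d(g t, h s)) / t]. Angles are therefore upper semicontinuous in
   all their endpoints, and since geodesics extend to a definite length, being
   strained is an open condition.

   Let [F = (d_p1, ..., d_pk)] be the strainer map and [x] in [V]. If [y] is close
   to [x] and [|F x - F y|] is much smaller than [d(x, y)], then [p1, ..., pk, x]
   is a strainer at [y]: by first variation the directions of [x], and of a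
   point [b] lying beyond [y] on an extension of [xy], make angles almost [pi / 2]
   with those of the [pi], and by semicontinuity no direction makes with them
   angles of sum much larger than [pi]. Hence [|F x - F y| >= e d(x, y)] for some
   [e] depending on [x] and all not strained [y] close to [x]; the sets of points
   where a given [e] works, cut into small pieces, are the required compact sets. *)

Set Implicit Arguments.
Unset Strict Implicit.
Unset Printing Implicit Defensive.

Import Order.TTheory GRing.Theory Num.Theory.
Import numFieldNormedType.Exports.

Local Open Scope classical_set_scope.
Local Open Scope ring_scope.

(* Semicontinuity bounds angles near [x] from above only, and uniformly only for geodesics whose
   length is bounded below. The geodesic from [y] back to [x] is not of this kind, as its length
   tends to 0. Its angles are controlled by first variation over the whole of [xy]: if [F x] and
   [F y] differ by at most [e d(x, y)], the cosines of its angles with the directions of the [pi]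
   are at least [- e], however short [xy] is.

   Lower bounds on angles are needed as well, since an opposite of [pi] is known only through its
   almost antipodal position. They come from the triangle inequality, the directions of [x] and [b]
   at [y] being at angle exactly [pi]. All mutual angles then come out below [pi / 2 + 3 * delta],
   within the required [12 * delta].

   The condition on opposite points quantifies over a completed space of directions. It is tested on
   geodesics of length [r0], which represent all directions and whose endpoints lie in a compact
   ball; this is where a definite length of extension matters. *)
Tactic Notation "lra_from" ne_hyp_list(hs) := clear - hs; lra.

(** * Generalized trigonometric functions *)

Section generalized_trigonometry.
Context {R : realType}.
Implicit Types (k s t u v a b C : R).

Definition cosh t : R := (expR t + expR (- t)) / 2.
Definition sinh t : R := (expR t - expR (- t)) / 2.

Lemma coshD a b : cosh (a + b) = cosh a * cosh b + sinh a * sinh b.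
Proof. by rewrite /cosh /sinh opprD !expRD; field. Qed.

Lemma sinhD a b : sinh (a + b) = sinh a * cosh b + cosh a * sinh b.
Proof. by rewrite /cosh /sinh opprD !expRD; field. Qed.

Lemma cosh2_sinh2 t : cosh t ^+ 2 - sinh t ^+ 2 = 1.
Proof.
have := expRxMexpNx_1 t; rewrite /cosh /sinh => e.
by rewrite -[RHS]e; field.
Qed.

Lemma coshN t : cosh (- t) = cosh t.
Proof. by rewrite /cosh opprK addrC. Qed.

Lemma sinhN t : sinh (- t) = - sinh t.
Proof. by rewrite /sinh opprK; field. Qed.

Lemma cosh_ge1 t : 1 <= cosh t.
Proof.
have := expRxMexpNx_1 t; have := expR_gt0 t; have := expR_gt0 (- t).
rewrite /cosh => b0 a0 e; have sq := sqr_ge0 (expR t - expR (- t)).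
rewrite leNgt; apply/negP => h.
have : 0 < (2 - (expR t + expR (- t))) * (2 + (expR t + expR (- t))).
  by rewrite mulr_gt0//; lra.
by move=> ?; nra.
Qed.

Lemma sinh_gt0 t : 0 < t -> 0 < sinh t.
Proof. by move=> t0; rewrite divr_gt0// subr_gt0 ltr_expR; lra. Qed.

Global Instance is_derive_cosh t : is_derive t 1 cosh (sinh t).
Proof.
have d : is_derive t 1 (fun x : R => expR (- x)) (- expR (- t)).
  have -> : - expR (- t) = expR (- t) * (- 1) by ring.
  exact: (@is_derive1_comp _ expR (fun x => - x)).
have -> : cosh = 2^-1 \*: (expR + (fun x : R => expR (- x))).
  by apply/funext => x; rewrite /cosh mulrC.
by apply: is_derive_eq; rewrite /sinh mulrC.
Qed.

Global Instance is_derive_sinh t : is_derive t 1 sinh (cosh t).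
Proof.
have d : is_derive t 1 (fun x : R => expR (- x)) (- expR (- t)).
  have -> : - expR (- t) = expR (- t) * (- 1) by ring.
  exact: (@is_derive1_comp _ expR (fun x => - x)).
have -> : sinh = 2^-1 \*: (expR - (fun x : R => expR (- x))).
  by apply/funext => x; rewrite /sinh mulrC.
by apply: is_derive_eq; rewrite /cosh opprK mulrC.
Qed.

(* [gsin] is the sine and [gver] the versine [(1 - cos) / k] of curvature [k]. The
   versine is used instead of the cosine since it still determines the distance
   when [k = 0]. *)
Definition gsin k t : R :=
  if 0 < k then sin (Num.sqrt k * t) / Num.sqrt k
  else if k < 0 then sinh (Num.sqrt (- k) * t) / Num.sqrt (- k)
  else t.

Definition gver k t : R :=
  if 0 < k then (1 - cos (Num.sqrt k * t)) / k
  else if k < 0 then (1 - cosh (Num.sqrt (- k) * t)) / k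
  else t ^+ 2 / 2.

Definition gcos k t : R := 1 - k * gver k t.

Lemma gcosE k t : gcos k t =
  if 0 < k then cos (Num.sqrt k * t)
  else if k < 0 then cosh (Num.sqrt (- k) * t) else 1.
Proof.
rewrite /gcos /gver; case: ltgtP => [k0|k0|<-]; last by rewrite mul0r subr0.
- by rewrite mulrC divfK ?gt_eqF// subKr.
- by rewrite mulrC divfK ?lt_eqF// subKr.
Qed.

Lemma gsinD k a b : gsin k (a + b) = gsin k a * gcos k b + gcos k a * gsin k b.
Proof.
rewrite !gcosE /gsin; case: (ltgtP 0 k) => k0.
- by rewrite mulrDr sinD; field; rewrite gt_eqF ?sqrtr_gt0.
- by rewrite mulrDr sinhD; field; rewrite gt_eqF ?sqrtr_gt0 ?oppr_gt0.
- by ring.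
Qed.

Lemma gverD k a b :
  gver k (a + b) = gver k a + gver k b - k * gver k a * gver k b + gsin k a * gsin k b.
Proof.
rewrite /gver /gsin; case: (ltgtP 0 k) => k0.
- rewrite mulrDr cosD.
  have ks : k = Num.sqrt k ^+ 2 by rewrite sqr_sqrtr ?ltW.
  have s0 : Num.sqrt k != 0 by rewrite gt_eqF// sqrtr_gt0.
  by move: (Num.sqrt k) ks s0 => r -> r0; field.
- rewrite mulrDr coshD.
  have ks : k = - Num.sqrt (- k) ^+ 2 by rewrite sqr_sqrtr ?opprK// oppr_ge0 ltW.
  have s0 : Num.sqrt (- k) != 0 by rewrite gt_eqF// sqrtr_gt0 oppr_gt0.
  by move: (Num.sqrt (- k)) ks s0 => r -> r0; field.
- by rewrite -k0; field.
Qed.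

Lemma gsin_sqr k t : gsin k t ^+ 2 = gver k t * (2 - k * gver k t).
Proof.
rewrite /gver /gsin; case: (ltgtP 0 k) => k0.
- have ks : k = Num.sqrt k ^+ 2 by rewrite sqr_sqrtr ?ltW.
  have s0 : Num.sqrt k != 0 by rewrite gt_eqF// sqrtr_gt0.
  by move: (Num.sqrt k) ks s0 => r -> r0; rewrite expr_div_n sin2cos2; field.
- have ks : k = - Num.sqrt (- k) ^+ 2 by rewrite sqr_sqrtr ?opprK// oppr_ge0 ltW.
  have s0 : Num.sqrt (- k) != 0 by rewrite gt_eqF// sqrtr_gt0 oppr_gt0.
  move: (Num.sqrt (- k)) ks s0 => r -> r0; rewrite expr_div_n.
  have := cosh2_sinh2 (r * t); move: (cosh _) (sinh _) => c s e.
  have -> : s ^+ 2 = c ^+ 2 - 1 by rewrite -e; ring.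
  by field.
- by rewrite -k0; field.
Qed.

Lemma gsinN k t : gsin k (- t) = - gsin k t.
Proof.
rewrite /gsin; case: (ltgtP 0 k) => k0 //.
- by rewrite mulrN sinN mulNr.
- by rewrite mulrN sinhN mulNr.
Qed.

Lemma gverN k t : gver k (- t) = gver k t.
Proof.
rewrite /gver; case: (ltgtP 0 k) => k0; last by rewrite sqrrN.
- by rewrite mulrN cosN.
- by rewrite mulrN coshN.
Qed.

Lemma gver0 k : gver k 0 = 0.
Proof.
rewrite /gver /cosh !mulr0 cos0 oppr0 expR0 expr0n/= mul0r.
by case: ltgtP => // k0; [rewrite subrr mul0r | rewrite mulfV// subrr mul0r].
Qed.

Lemma gsin0 k : gsin k 0 = 0.
Proof. by have := gsinN k 0; rewrite oppr0 => ?; lra. Qed.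

Lemma gsinB k a b : gsin k (a - b) = gsin k a * gcos k b - gcos k a * gsin k b.
Proof. by rewrite gsinD gsinN /gcos gverN; ring. Qed.

Lemma gverB k a b :
  gver k (a - b) = gver k a + gver k b - k * gver k a * gver k b - gsin k a * gsin k b.
Proof. by rewrite gverD gsinN gverN; ring. Qed.

Global Instance is_derive_gver k t : is_derive t 1 (gver k) (gsin k t).
Proof.
rewrite /gsin; case: (ltgtP 0 k) => k0.
- have -> : gver k = k^-1 \*: (cst 1 - (cos \o *%R (Num.sqrt k))).
    by apply/funext => x; rewrite /gver k0 mulrC.
  have ds : is_derive t 1 ( *%R (Num.sqrt k)) (Num.sqrt k).
    have -> : *%R (Num.sqrt k) = Num.sqrt k \*: id by apply/funext.
    by apply: is_derive_eq; rewrite /GRing.scale/= mulr1.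
  have dc := @is_derive1_comp _ cos _ _ _ _ (is_derive_cos _) ds.
  apply: is_derive_eq; rewrite /GRing.scale/= sub0r.
  have ks : k = Num.sqrt k ^+ 2 by rewrite sqr_sqrtr ?ltW.
  have s0 : Num.sqrt k != 0 by rewrite gt_eqF// sqrtr_gt0.
  by rewrite {1}ks; field.
- have -> : gver k = k^-1 \*: (cst 1 - (cosh \o *%R (Num.sqrt (- k)))).
    by apply/funext => x; rewrite /gver ltNge (ltW k0)/= k0 mulrC.
  have ds : is_derive t 1 ( *%R (Num.sqrt (- k))) (Num.sqrt (- k)).
    have -> : *%R (Num.sqrt (- k)) = Num.sqrt (- k) \*: id by apply/funext.
    by apply: is_derive_eq; rewrite /GRing.scale/= mulr1.
  have dc := @is_derive1_comp _ cosh _ _ _ _ (is_derive_cosh _) ds.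
  apply: is_derive_eq; rewrite /GRing.scale/= sub0r.
  have ks : k = - Num.sqrt (- k) ^+ 2 by rewrite sqr_sqrtr ?opprK// oppr_ge0 ltW.
  have s0 : Num.sqrt (- k) != 0 by rewrite gt_eqF// sqrtr_gt0 oppr_gt0.
  by rewrite {1}ks; field.
- have -> : gver k = 2^-1 \*: (id ^+ 2).
    by apply/funext => x; rewrite /gver -k0 ltxx mulrC.
  by apply: is_derive_eq; rewrite /GRing.scale/= expr1 mulr1; field.
Qed.

Global Instance is_derive_gsin k t : is_derive t 1 (gsin k) (gcos k t).
Proof.
rewrite gcosE; case: (ltgtP 0 k) => k0.
- have -> : gsin k = (Num.sqrt k)^-1 \*: (sin \o *%R (Num.sqrt k)).
    by apply/funext => x; rewrite /gsin k0 mulrC.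
  have ds : is_derive t 1 ( *%R (Num.sqrt k)) (Num.sqrt k).
    have -> : *%R (Num.sqrt k) = Num.sqrt k \*: id by apply/funext.
    by apply: is_derive_eq; rewrite /GRing.scale/= mulr1.
  have dc := @is_derive1_comp _ sin _ _ _ _ (is_derive_sin _) ds.
  apply: is_derive_eq; rewrite /GRing.scale/=.
  have s0 : Num.sqrt k != 0 by rewrite gt_eqF// sqrtr_gt0.
  by field.
- have -> : gsin k = (Num.sqrt (- k))^-1 \*: (sinh \o *%R (Num.sqrt (- k))).
    by apply/funext => x; rewrite /gsin ltNge (ltW k0)/= k0 mulrC.
  have ds : is_derive t 1 ( *%R (Num.sqrt (- k))) (Num.sqrt (- k)).
    have -> : *%R (Num.sqrt (- k)) = Num.sqrt (- k) \*: id by apply/funext.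
    by apply: is_derive_eq; rewrite /GRing.scale/= mulr1.
  have dc := @is_derive1_comp _ sinh _ _ _ _ (is_derive_sinh _) ds.
  apply: is_derive_eq; rewrite /GRing.scale/=.
  have s0 : Num.sqrt (- k) != 0 by rewrite gt_eqF// sqrtr_gt0 oppr_gt0.
  by field.
- have -> : gsin k = id by apply/funext => x; rewrite /gsin -k0 ltxx.
  exact: is_derive_id.
Qed.

Lemma continuous_gver k : continuous (gver k).
Proof.
by move=> t; apply/differentiable_continuous/derivable1_diffP; apply: ex_derive.
Qed.

Lemma continuous_gsin k : continuous (gsin k).
Proof.
by move=> t; apply/differentiable_continuous/derivable1_diffP; apply: ex_derive.
Qed.

(* The interval [0, R_k] of all distances in the model plane. *)
Definition diam_itv k t : bool := (0 <= t) && ((0 < k) ==> (Num.sqrt k * t <= pi)).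

Lemma gsin_gt0 k t : 0 < t -> (0 < k -> Num.sqrt k * t < pi) -> 0 < gsin k t.
Proof.
move=> t0 ht; rewrite /gsin; case: (ltgtP 0 k) => k0//.
- rewrite divr_gt0 ?sqrtr_gt0// sin_gt0_pi// ht// andbT mulr_gt0// sqrtr_gt0//.
- by rewrite divr_gt0 ?sqrtr_gt0 ?oppr_gt0// sinh_gt0// mulr_gt0// sqrtr_gt0 oppr_gt0.
Qed.

Lemma gsin_ge0 k t : diam_itv k t -> 0 <= gsin k t.
Proof.
move=> /andP[t0 /implyP ht]; rewrite /gsin; case: (ltgtP 0 k) => k0//.
- by rewrite divr_ge0 ?sqrtr_ge0// sin_ge0_pi// ht// andbT mulr_ge0// sqrtr_ge0.
- rewrite divr_ge0 ?sqrtr_ge0//; move: t0; rewrite le_eqVlt => /predU1P[<-|t0].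
    by rewrite mulr0 /sinh oppr0 subrr mul0r.
  by rewrite ltW// sinh_gt0// mulr_gt0// sqrtr_gt0 oppr_gt0.
Qed.

Lemma gcos_gt0 k t : (0 < k -> Num.sqrt k * `|t| < pi / 2) -> 0 < gcos k t.
Proof.
move=> ht; rewrite gcosE; case: (ltgtP 0 k) => k0//.
- have := ht k0; rewrite -[X in X * `|t|]ger0_norm ?sqrtr_ge0// -normrM ltr_norml.
  exact: cos_gt0_pihalf.
- by rewrite (lt_le_trans ltr01)// cosh_ge1.
Qed.

(** The derivative [gsin] is positive inside the interval. Inequalities between versines, which is
    what the trigonometric identities deliver, become inequalities between distances in this way. *)
Lemma gver_mono k : {in diam_itv k &, {mono gver k : s t / s <= t}}.
Proof.
suff h s t : diam_itv k s -> diam_itv k t -> s < t -> gver k s < gver k t.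
  apply: le_mono_in => s t; exact: h.
move=> /andP[s0 /implyP hs] /andP[t0 /implyP ht] st.
have [c] := @MVT _ (gver k) (gsin k) s t st (fun x _ => is_derive_gver k x)
  (continuous_subspaceT (@continuous_gver k)).
rewrite in_itv/= => /andP[sc ct] e; rewrite -subr_gt0 e mulr_gt0 ?subr_gt0//.
apply: gsin_gt0 => [|k0]; first exact: le_lt_trans sc.
by rewrite (lt_le_trans _ (ht k0))// ltr_pM2l// sqrtr_gt0.
Qed.

Lemma gcos_cvg1 k (e : R) : 0 < e ->
  exists2 d : R, 0 < d & forall t, `|t| < d -> `|gcos k t - 1| < e.
Proof.
move=> e0.
have /cvgrPdist_lt/(_ e e0) : gcos k t @[t --> (0 : R)] --> (1 : R).
  rewrite [X in _ --> X](_ : _ = 1 - k * gver k 0); last by rewrite gver0 mulr0 subr0.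
  apply: cvgB; first exact: cvg_cst.
  by apply: cvgM; [exact: cvg_cst|exact: continuous_gver].
move=> /nbhs_ballP[d /= d0 hd]; exists d => // t td.
by have := hd t; rewrite /ball/= sub0r normrN distrC => /(_ td).
Qed.

(** Near 0 the derivative [gcos] is within [e] of 1. With the next lemma this turns curved
    comparison into Euclidean comparison up to a small relative error. *)
Lemma gsin_lip_near0 k (e : R) : 0 < e ->
  exists2 d : R, 0 < d & forall s t, - d < s -> s <= t -> t < d ->
    gsin k t - gsin k s <= (1 + e) * (t - s).
Proof.
move=> e0; have [d d0 hd] := @gcos_cvg1 k e e0; exists d => // s t ds st td.
have [c] := @MVT_segment _ (gsin k) (gcos k) s t st (fun x _ => is_derive_gsin k x)
  (continuous_subspaceT (@continuous_gsin k)).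
rewrite in_itv/= => /andP[sc ct] ->; rewrite ler_wpM2r ?subr_ge0//.
have /hd : `|c| < d by rewrite ltr_norml; apply/andP; split; lra.
by rewrite ltr_distl => /andP[_ /ltW]; lra.
Qed.

(** As [gver 0 t] is [t ^+ 2 / 2], the mean value theorem for [gver k - (1 - e) * gver 0], and once
    more for [gsin k], reduces the claim to [gcos k] being close to 1. *)
Lemma gver_growth_near0 k (e : R) : 0 < e ->
  exists2 d : R, 0 < d & forall s t, 0 <= s -> s <= t -> t < d ->
    (1 - e) * ((t ^+ 2 - s ^+ 2) / 2) <= gver k t - gver k s.
Proof.
move=> e0; have [d d0 hd] := @gcos_cvg1 k e e0; exists d => // s t s0 st td.
pose f (x : R) : R := gver k x - (1 - e) * gver 0 x.
have df (x : R) : is_derive x 1 f (gsin k x - (1 - e) * gsin 0 x).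
  have -> : f = gver k - (1 - e) \*: gver 0 by [].
  exact: is_deriveB.
have cf : continuous f.
  move=> x; apply: cvgB; first exact: continuous_gver.
  by apply: cvgM; [exact: cvg_cst|exact: continuous_gver].
have [c] := @MVT_segment _ f (fun x => gsin k x - (1 - e) * gsin 0 x) s t st
  (fun x _ => df x) (continuous_subspaceT cf).
rewrite in_itv/= => /andP[sc ct] ef.
suff : 0 <= f t - f s by rewrite /f /gver ltxx; lra.
rewrite ef mulr_ge0 ?subr_ge0//.
have [c' ] := @MVT_segment _ (gsin k) (gcos k) 0 c (le_trans s0 sc)
  (fun x _ => is_derive_gsin k x) (continuous_subspaceT (@continuous_gsin k)).
rewrite in_itv/= => /andP[c'0 c'c]; rewrite gsin0 !subr0 => ->.
rewrite {1}/gsin ltxx ler_wpM2r ?(le_trans s0)//.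
have /hd : `|c'| < d by rewrite ltr_norml; apply/andP; split; lra.
by rewrite ltr_distl => /andP[/ltW]; lra.
Qed.

End generalized_trigonometry.

(** * Model planes *)

Section model_points.
Context {R : realType}.
Implicit Types (k r b C D : R).

Lemma cosh_arcosh (t : R) : 1 <= t -> cosh (arcosh t) = t.
Proof.
move=> t1; rewrite /arcosh; set q := Num.sqrt _.
have q2 : q ^+ 2 = t ^+ 2 - 1 by rewrite sqr_sqrtr// subr_ge0 expr_ge1// (le_trans ler01).
have y0 : 0 < t + q by rewrite ltr_pwDl ?sqrtr_ge0// (lt_le_trans ltr01).
have y1 : (t + q)^-1 = t - q.
  apply: (mulfI (lt0r_neq0 y0)); rewrite mulfV ?gt_eqF//.
  have -> : (t + q) * (t - q) = t ^+ 2 - q ^+ 2 by ring.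
  by rewrite q2; ring.
by rewrite /cosh expRN lnK ?posrE// y1; field.
Qed.

Lemma arcosh_ge0 (t : R) : 1 <= t -> 0 <= arcosh t.
Proof. by move=> t1; rewrite ln_ge0// (le_trans t1)// lerDl sqrtr_ge0. Qed.

(* The point with polar coordinates [r] and [acos C]; the factor [w] is there because
   the model planes of [k != 0] are not rescaled. *)
Definition model_pt k r C : 'rV[R]_3 :=
  let w := if k == 0 then 1 else Num.sqrt `|k| in
  \row_(i < 3) [:: if k == 0 then 0 else gcos k r;
                   w * gsin k r * C; w * gsin k r * Num.sqrt (1 - C ^+ 2)]`_i.

Lemma dotE3 (u v : 'rV[R]_3) :
  dot u v = u 0 0 * v 0 0 + (u 0 (lift 0 0) * v 0 (lift 0 0) +
    u 0 (lift 0 (lift 0 0)) * v 0 (lift 0 (lift 0 0))).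
Proof.
by rewrite /dot !big_ord_recl big_ord0 addr0.
Qed.

Lemma lorentzE3 (u v : 'rV[R]_3) : lorentz u v =
  u 0 0 * v 0 0 - (u 0 (lift 0 0) * v 0 (lift 0 0) +
    u 0 (lift 0 (lift 0 0)) * v 0 (lift 0 (lift 0 0))).
Proof.
by rewrite /lorentz big_mkcond !big_ord_recl big_ord0 /= addr0 add0r.
Qed.

Lemma model_ptE k r C : let w := if k == 0 then 1 else Num.sqrt `|k| in
  (model_pt k r C 0 0 = if k == 0 then 0 else gcos k r) *
  (model_pt k r C 0 (lift 0 0) = w * gsin k r * C) *
  (model_pt k r C 0 (lift 0 (lift 0 0)) = w * gsin k r * Num.sqrt (1 - C ^+ 2)).
Proof. by rewrite !mxE. Qed.

Lemma dot_model_pt k r C b C' : 0 < k ->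
  dot (model_pt k r C) (model_pt k b C') = gcos k r * gcos k b +
    k * gsin k r * gsin k b * (C * C' + Num.sqrt (1 - C ^+ 2) * Num.sqrt (1 - C' ^+ 2)).
Proof.
move=> k0; rewrite dotE3 !model_ptE gt_eqF// gtr0_norm//.
have ks := sqr_sqrtr (ltW k0); move: (Num.sqrt k) ks => w ks.
by rewrite -[X in _ + X * _ * _ * _]ks; ring.
Qed.

Lemma lorentz_model_pt k r C b C' : k < 0 ->
  lorentz (model_pt k r C) (model_pt k b C') = gcos k r * gcos k b +
    k * gsin k r * gsin k b * (C * C' + Num.sqrt (1 - C ^+ 2) * Num.sqrt (1 - C' ^+ 2)).
Proof.
move=> k0; rewrite lorentzE3 !model_ptE lt_eqF// ltr0_norm//.
have ks : - Num.sqrt (- k) ^+ 2 = k by rewrite sqr_sqrtr ?opprK// oppr_ge0 ltW.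
by move: (Num.sqrt _) ks => w ks; by rewrite -[X in _ + X * _ * _ * _]ks; ring.
Qed.

Lemma gcos2_gsin2 k r : gcos k r ^+ 2 + k * gsin k r ^+ 2 = 1.
Proof. by rewrite gsin_sqr /gcos; ring. Qed.

Lemma sqr1_ge0 C : -1 <= C <= 1 -> 0 <= 1 - C ^+ 2.
Proof.
move=> /andP[C1 C2]; have -> : 1 - C ^+ 2 = (1 - C) * (1 + C) by ring.
by rewrite mulr_ge0//; lra.
Qed.

Lemma model_plane_pt k r C : -1 <= C <= 1 -> model_plane k (model_pt k r C).
Proof.
move=> C1; have s2 : Num.sqrt (1 - C ^+ 2) ^+ 2 = 1 - C ^+ 2 by rewrite sqr_sqrtr// sqr1_ge0.
rewrite /model_plane; case: (ltgtP 0 k) => k0 /=.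
- by rewrite dot_model_pt// -!expr2 s2 -[RHS](gcos2_gsin2 k r); ring.
- split; first by rewrite lorentz_model_pt// -!expr2 s2 -[RHS](gcos2_gsin2 k r); ring.
  rewrite model_ptE lt_eqF// gcos_gt0// => k1.
  by have := lt_trans k0 k1; rewrite ltxx.
- by rewrite model_ptE -k0 eqxx.
Qed.

Lemma model_distC k (u v : 'rV[R]_3) : model_dist k u v = model_dist k v u.
Proof.
rewrite /model_dist; case: ifP => _; first by rewrite !dotE3; congr (acos _ / _); ring.
case: ifP => _; first by rewrite !lorentzE3; congr (arcosh _ / _); ring.
by rewrite /eucl_dist !dotE3 !mxE; congr Num.sqrt; ring.
Qed.

Lemma model_distxx k (u : 'rV[R]_3) : model_plane k u -> model_dist k u u = 0.
Proof.
rewrite /model_plane /model_dist; case: ifP => _ /=; first by move=> ->; rewrite acos1 mul0r.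
case: ifP => _ /=; first by case=> -> _; rewrite /arcosh expr1n subrr sqrtr0 addr0 ln1 mul0r.
by rewrite /eucl_dist subrr dotE3 !mxE !mul0r !addr0 sqrtr0.
Qed.

(** The law of cosines for a triangle with a vertex at the pole and an angle of cosine [C] there.
    With [gver k (r - b)] as leading term it has the same form for every sign of [k]. *)
Lemma model_dist_pt k r b C : diam_itv k r -> diam_itv k b -> -1 <= C <= 1 ->
  let D := model_dist k (model_pt k r 1) (model_pt k b C) in
  diam_itv k D /\ gver k D = gver k (r - b) + gsin k r * gsin k b * (1 - C).
Proof.
(* For [k != 0], [x] is the value of the bilinear form at the two points. The identities below place
   it in the range where [acos] or [arcosh] can be inverted. *)
move=> rk bk C1 D; pose x := gcos k r * gcos k b + k * gsin k r * gsin k b * C.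
have ss0 : 0 <= gsin k r * gsin k b by rewrite mulr_ge0// gsin_ge0.
have xE : gver k (r - b) + gsin k r * gsin k b * (1 - C) =
    gver k r + gver k b - k * gver k r * gver k b - gsin k r * gsin k b * C.
  by rewrite gverB; ring.
have kx : 1 - x = k * (gver k (r - b) + gsin k r * gsin k b * (1 - C)).
  by rewrite xE /x /gcos; ring.
have x_le : 1 - x = (1 - gcos k (r - b)) + k * (gsin k r * gsin k b * (1 - C)).
  by rewrite kx /gcos; ring.
have x_ge : 1 + x = (1 + gcos k (r + b)) + k * (gsin k r * gsin k b * (1 + C)).
  by rewrite /x /gcos gverD; ring.
rewrite /D /model_dist; case: (ltgtP 0 k) => k0.
- have s0 : 0 < Num.sqrt k by rewrite sqrtr_gt0.
  have -> : dot (model_pt k r 1) (model_pt k b C) = x.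
    by rewrite dot_model_pt// expr1n subrr sqrtr0 /x; ring.
  have x1 : -1 <= x <= 1.
    apply/andP; split.
      rewrite -subr_ge0 opprK addrC x_ge addr_ge0//.
        by rewrite gcosE k0; have := cos_geN1 (Num.sqrt k * (r + b)); lra.
      by rewrite mulr_ge0 ?(ltW k0)// mulr_ge0//; lra.
    rewrite -subr_ge0 x_le addr_ge0//.
      by rewrite gcosE k0; have := cos_le1 (Num.sqrt k * (r - b)); lra.
    by rewrite mulr_ge0 ?(ltW k0)// mulr_ge0//; lra.
  split.
    rewrite /diam_itv divr_ge0 ?sqrtr_ge0 ?acos_ge0//= k0 /=.
    by rewrite mulrC divfK ?gt_eqF// acos_lepi.
  rewrite {1}/gver k0 [_ * (_ / _)]mulrC divfK ?gt_eqF// acosK ?in_itv// kx.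
  by field; rewrite gt_eqF.
- have s0 : 0 < Num.sqrt (- k) by rewrite sqrtr_gt0 oppr_gt0.
  have -> : lorentz (model_pt k r 1) (model_pt k b C) = x.
    by rewrite lorentz_model_pt// expr1n subrr sqrtr0 /x; ring.
  have x1 : 1 <= x.
    rewrite -subr_le0 kx mulr_le0_ge0 ?(ltW k0)// addr_ge0//; last by rewrite mulr_ge0//; lra.
    rewrite /gver (ltNge 0 k) (ltW k0)/= k0 mulr_le0 ?invr_le0 ?(ltW k0)//.
    by rewrite subr_le0 cosh_ge1.
  split.
    by rewrite /diam_itv divr_ge0 ?sqrtr_ge0 ?arcosh_ge0//= (ltNge 0 k) (ltW k0).
  rewrite {1}/gver (ltNge 0 k) (ltW k0)/= k0 [_ * (_ / _)]mulrC divfK ?gt_eqF// cosh_arcosh// kx.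
  by field; rewrite lt_eqF.
- rewrite /eucl_dist; split; first by rewrite /diam_itv sqrtr_ge0 -k0 ltxx.
  rewrite /gver -k0 ltxx.
  have e : dot (model_pt 0 r 1 - model_pt 0 b C) (model_pt 0 r 1 - model_pt 0 b C) =
      (r - b * C) ^+ 2 + b ^+ 2 * (1 - C ^+ 2).
    have mxB i : (model_pt 0 r 1 - model_pt 0 b C) 0 i =
        model_pt 0 r 1 0 i - model_pt 0 b C 0 i by rewrite !mxE.
    rewrite -[in RHS](sqr_sqrtr (sqr1_ge0 C1)) dotE3 !mxB !model_ptE eqxx.
    have -> : Num.sqrt (1 - 1 ^+ 2) = 0 :> R by rewrite expr1n subrr sqrtr0.
    by rewrite /gsin ltxx; ring.
  have e0 : 0 <= (r - b * C) ^+ 2 + b ^+ 2 * (1 - C ^+ 2).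
    by rewrite addr_ge0 ?sqr_ge0// mulr_ge0 ?sqr_ge0// sqr1_ge0.
  rewrite e sqr_sqrtr//.
  by rewrite /gsin ltxx; field.
Qed.

Lemma model_diam_le k : 0 < k -> (model_diam k <= (pi / Num.sqrt k)%:E)%E.
Proof.
move=> k0; apply: ge_ereal_sup => _ [u [v [+ + ->]]].
rewrite /model_plane /model_dist k0 /= => u1 v1; rewrite lee_fin ler_pM2r ?invr_gt0 ?sqrtr_gt0//.
have d_ge0 (w : 'rV[R]_3) : 0 <= dot w w by apply: sumr_ge0 => i _; rewrite -expr2 sqr_ge0.
rewrite acos_lepi//; have := d_ge0 (u - v); have := d_ge0 (u + v).
move: u1 v1; rewrite !dotE3 !mxE => u1 v1 p m; apply/andP; split; nra.
Qed.

End model_points.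

(** * Comparison in a tiny ball *)

Section tiny_ball.
Context {R : realType} {X : metricType R} (kappa : R) (x0 : X) (r0 : R).
Hypothesis hU : tiny_ball kappa x0 r0.
Implicit Types (x y z p q r : X) (s t : R).

Local Notation W := (closed_mball x0 (10 * r0)).
Local Notation sn := (gsin kappa).
Local Notation ver := (gver kappa).
Local Notation cs := (gcos kappa).

Lemma tiny_radius_gt0 : 0 < r0.
Proof. by case: hU. Qed.

Lemma tiny_radius_diam : ((100 * r0)%:E <= model_diam kappa)%E.
Proof.
case: hU => _ + _ _; rewrite le_min => /andP[_].
by rewrite lee_pdivlMl.
Qed.

(** Two points of the ball of radius [10 * r0] are at distance at most [20 * r0], and sums of two
    such distances are at most [40 * r0]. Since [100 * r0] is at most [pi / sqrt kappa], these sums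
    stay below a right angle, where [gsin] and [gcos] are both positive. *)
Lemma tiny_diam_itv t : 0 < t -> t <= 40 * r0 -> 0 < kappa -> Num.sqrt kappa * t < pi / 2.
Proof.
move=> t0 ht k0; have s0 : 0 < Num.sqrt kappa by rewrite sqrtr_gt0.
have := le_trans tiny_radius_diam (model_diam_le k0); rewrite lee_fin ler_pdivlMr//.
have r00 := tiny_radius_gt0; have : Num.sqrt kappa * t <= Num.sqrt kappa * (40 * r0).
  by rewrite ler_wpM2l// ltW.
have : 0 < r0 * Num.sqrt kappa by rewrite mulr_gt0.
by lra.
Qed.

Lemma diam_itv_tiny t : 0 <= t <= 40 * r0 -> diam_itv kappa t.
Proof.
move=> /andP[t0 t40]; rewrite /diam_itv t0; apply/implyP => k0.
move: t0; rewrite le_eqVlt => /predU1P[<-|t0]; first by rewrite mulr0 pi_ge0.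
by have := tiny_diam_itv t0 t40 k0; have := @pi_gt0 R; lra.
Qed.

Lemma tiny_gsin_gt0 t : 0 < t <= 40 * r0 -> 0 < sn t.
Proof.
move=> /andP[t0 t40]; apply: gsin_gt0 => // k0.
by have := tiny_diam_itv t0 t40 k0; have := @pi_gt0 R; lra.
Qed.

Lemma tiny_gcos_gt0 t : `|t| <= 40 * r0 -> 0 < cs t.
Proof.
move=> ht; apply: gcos_gt0 => k0; have [->|t0] := eqVneq t 0.
  by rewrite normr0 mulr0 divr_gt0// pi_gt0.
by apply: tiny_diam_itv => //; rewrite normr_gt0.
Qed.

Lemma tiny_gver_mono : {in `[0, 40 * r0] &, {mono ver : s t / s <= t}}.
Proof.
move=> s t; rewrite !in_itv/= => hs ht.
by apply: gver_mono; exact: diam_itv_tiny.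
Qed.

Lemma mdist_tiny x y : W x -> W y -> mdist x y <= 20 * r0.
Proof.
rewrite /closed_mball /= => hx hy.
by have := metric_triangle x x0 y; rewrite (metric_sym x x0); lra.
Qed.

Lemma lt_model_diam t : t <= 60 * r0 -> (t%:E < model_diam kappa)%E.
Proof.
move=> ht; apply: lt_le_trans tiny_radius_diam; rewrite lte_fin.
by have := tiny_radius_gt0; lra.
Qed.

Lemma lt_model_diam2 t : t <= 60 * r0 -> (t%:E < 2%:E * model_diam kappa)%E.
Proof.
move=> ht; apply: lt_le_trans (_ : ((2 * (100 * r0))%:E <= _)%E).
  by rewrite lte_fin; have := tiny_radius_gt0; lra.
by rewrite EFinM lee_pmul2l// tiny_radius_diam.
Qed.

Lemma tiny_geodesic x y : W x -> W y -> exists g, geodesic_within W x y g.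
Proof.
move=> hx hy; case: hU => _ _ _ [_ + _]; apply => //; apply: lt_model_diam.
by have := mdist_tiny hx hy; have := tiny_radius_gt0; lra.
Qed.

(** The law of cosines is solved for [C]. The triangle inequalities say that [ver a] lies between
    [ver (l - b)] and [ver (l + b)], which differ by [2 * sn l * sn b], so that [C] lies in
    [[-1, 1]]. *)
Lemma model_angle_exists (l b a : R) : 0 <= l <= 20 * r0 -> 0 <= b <= 20 * r0 ->
  0 <= a -> a <= l + b -> l - b <= a -> b - l <= a ->
  exists2 C, -1 <= C <= 1 & ver a = ver (l - b) + sn l * sn b * (1 - C).
Proof.
move=> hl hb a0 alb lba bla.
have [hl0|l0] := eqVneq l 0.
  exists 1; first by lra.
  have -> : a = b by lra.
  by rewrite hl0 sub0r gverN gsin0; ring.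
have [hb0|b0] := eqVneq b 0.
  exists 1; first by lra.
  have -> : a = l by lra.
  by rewrite hb0 subr0 gsin0; ring.
have sl : 0 < sn l by apply: tiny_gsin_gt0; move: hl; rewrite (lt_neqAle 0) eq_sym l0/=; lra.
have sb : 0 < sn b by apply: tiny_gsin_gt0; move: hb; rewrite (lt_neqAle 0) eq_sym b0/=; lra.
have ss := mulr_gt0 sl sb.
exists (1 - (ver a - ver (l - b)) / (sn l * sn b)); last by field; rewrite gt_eqF// gt_eqF.
have m1 : ver (l - b) <= ver a.
  have [bl|lb] := leP b l.
    by rewrite tiny_gver_mono// in_itv/=; lra.
  by rewrite -gverN tiny_gver_mono// ?in_itv/=; lra.
have m2 : ver a <= ver (l + b) by rewrite tiny_gver_mono// in_itv/=; lra.
have e2 : ver (l + b) = ver (l - b) + 2 * (sn l * sn b) by rewrite gverD gverB; ring.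
have q0 : 0 <= (ver a - ver (l - b)) / (sn l * sn b) by rewrite divr_ge0 ?(ltW ss)//; lra.
have q2 : (ver a - ver (l - b)) / (sn l * sn b) <= 2 by rewrite ler_pdivrMr//; lra.
by lra.
Qed.

(** [P] is the pole, [Q] and [S] lie on one ray and [T] on the ray at angle [acos C]. The last
    identity is Stewart's theorem in the model plane, obtained by eliminating [C] from the laws of
    cosines for [QT] and [ST]. *)
Lemma model_triangle_exists (l b a s : R) :
  0 <= l <= 20 * r0 -> 0 <= b <= 20 * r0 -> 0 <= a <= 20 * r0 ->
  a <= l + b -> l - b <= a -> b - l <= a -> 0 <= s <= l ->
  exists P Q T S : 'rV[R]_3,
    [/\ model_plane kappa P, model_plane kappa Q, model_plane kappa T & model_plane kappa S] /\
    [/\ model_dist kappa P Q = l, model_dist kappa Q T = a & model_dist kappa T P = b] /\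
    [/\ model_dist kappa P S = s, model_dist kappa S Q = l - s,
        diam_itv kappa (model_dist kappa S T) &
        ver (model_dist kappa S T) * sn l =
          sn (l - s) * (ver b - ver s) + sn s * (ver a - ver (l - s))].
Proof.
move=> hl hb ha alb lba bla hs.
have r00 := tiny_radius_gt0.
have hl4 : 0 <= l <= 40 * r0 by lra.
have hb4 : 0 <= b <= 40 * r0 by lra.
have ha4 : 0 <= a <= 40 * r0 by lra.
have hs4 : 0 <= s <= 40 * r0 by lra.
have hls4 : 0 <= l - s <= 40 * r0 by lra.
have h04 : 0 <= (0 : R) <= 40 * r0 by lra.
have one : -1 <= (1 : R) <= 1 by lra.
have a0 : 0 <= a by lra.
have s0 : 0 <= s by lra.
have sl : s <= l by lra.
have di t : 0 <= t <= 40 * r0 -> diam_itv kappa t by exact: diam_itv_tiny.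
have eqd (u v : 'rV[R]_3) t : diam_itv kappa (model_dist kappa u v) -> 0 <= t <= 40 * r0 ->
    ver (model_dist kappa u v) = ver t -> model_dist kappa u v = t.
  move=> du ht e; have dt := di t ht.
  by apply/eqP; rewrite eq_le; apply/andP; split;
    rewrite -(gver_mono (k := kappa)) ?unfold_in// e.
have [C C1 aE] := model_angle_exists hl hb a0 alb lba bla.
have inv t C' : 0 <= t <= 40 * r0 -> -1 <= C' <= 1 ->
    model_dist kappa (model_pt kappa 0 1) (model_pt kappa t C') = t.
  move=> ht hC; have [d e] := model_dist_pt (di 0 h04) (di t ht) hC.
  by apply: eqd => //; rewrite e sub0r gverN gsin0 !mul0r addr0.
exists (model_pt kappa 0 1), (model_pt kappa l 1), (model_pt kappa b C), (model_pt kappa s 1).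
split; first by split; exact: model_plane_pt.
split; split.
- exact: inv.
- have [d e] := model_dist_pt (di l hl4) (di b hb4) C1.
  by apply: eqd => //; rewrite e aE.
- by rewrite model_distC; exact: inv.
- exact: inv.
- have [d e] := model_dist_pt (di s hs4) (di l hl4) one.
  apply: eqd => //; rewrite e subrr mulr0 addr0 -(gverN _ (l - s)) opprB//.
- by have [] := model_dist_pt (di s hs4) (di b hb4) C1.
- have [_ ->] := model_dist_pt (di s hs4) (di b hb4) C1.
  have -> : (ver (s - b) + sn s * sn b * (1 - C)) * sn l =
    ver (s - b) * sn l + sn s * (sn l * sn b * (1 - C)) by ring.
  have -> : sn l * sn b * (1 - C) = ver a - ver (l - b) by rewrite aE; ring.
  rewrite gsinB !gverB /gcos.
  have e := gsin_sqr kappa s.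
  by ring: e.
Qed.

(* For [kappa = 1] this reads
   [sin (l - s) * cos b + sin s * cos a <= cos d * sin l]. *)
Lemma tiny_vertex_comparison p q r (g : R -> X) s :
  W p -> W q -> W r -> geodesic_within W p q g -> 0 <= s <= mdist p q ->
  ver (mdist (g s) r) * sn (mdist p q) <=
    sn (mdist p q - s) * (ver (mdist p r) - ver s) +
    sn s * (ver (mdist q r) - ver (mdist p q - s)).
Proof.
move=> hp hq hr hg hs; have [[gg g0 gl] gW] := hg.
have [s0 sl] := andP hs; have l0 := mdist_ge0 p q.
have gsp : mdist p (g s) = s.
  have := gg 0 s; rewrite g0 sub0r normrN ger0_norm//.
  by apply; rewrite /= in_itv/= ?lexx ?mdist_ge0.
have gsq : mdist (g s) q = mdist p q - s.
  have := gg s (mdist p q); rewrite gl distrC ger0_norm ?subr_ge0//.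
  by apply; rewrite /= in_itv/= ?lexx ?mdist_ge0// s0.
have Wgs : W (g s) by apply: gW; rewrite /= in_itv.
have lb : 0 <= mdist p q <= 20 * r0 by rewrite mdist_ge0 mdist_tiny.
have bb : 0 <= mdist p r <= 20 * r0 by rewrite mdist_ge0 mdist_tiny.
have ab : 0 <= mdist q r <= 20 * r0 by rewrite mdist_ge0 mdist_tiny.
have t1 : mdist q r <= mdist p q + mdist p r by rewrite (metric_sym p q) metric_triangle.
have t2 : mdist p q - mdist p r <= mdist q r.
  by rewrite lerBlDr addrC (metric_sym q r) metric_triangle.
have t3 : mdist p r - mdist p q <= mdist q r by rewrite lerBlDr addrC metric_triangle.
have [P [Q [T [S [[hP hQ hT hS] [[PQ QT TP] [PS SQ dST eST]]]]]]] :=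
  model_triangle_exists lb bb ab t1 t2 t3 hs.
have [gr hgr] := tiny_geodesic hq hr; have [gp hgp] := tiny_geodesic hr hp.
have gp0 : gp 0 = r by case: hgp => -[].
(* The vertex [r] is the point of parameter 0 on the side from [r] to [p], so the comparison between
   points of two sides applies to it. *)
have le_d : mdist (gp 0) (g s) <= model_dist kappa S T.
  rewrite metric_sym; case: hU => _ _ _ [_ _ thin].
  apply: (thin p q r g gr gp hp hq hr hg hgr hgp _ _ _ _ _ P Q T).
  - by apply: lt_model_diam2; rewrite (metric_sym r p); lra.
  - by rewrite /= in_itv.
  - by rewrite /= in_itv/= lexx mdist_ge0.
  - by split=> //; split; rewrite // (metric_sym r p).
  - by split; rewrite ?gsp ?gsq.
  - by rewrite gp0; split; rewrite ?mdistxx ?model_distxx ?(metric_sym r p).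
rewrite -eST ler_wpM2r//; first by apply: gsin_ge0; apply: diam_itv_tiny; lra.
rewrite (gver_mono (k := kappa)) ?unfold_in//.
  by rewrite metric_sym -gp0.
apply: diam_itv_tiny; rewrite mdist_ge0/=; have := mdist_tiny Wgs hr.
by have := tiny_radius_gt0; lra.
Qed.

End tiny_ball.

(** * Geodesics in a tiny ball *)

Lemma lipschitz_within_continuous {R : realType} (A : set R) (f : R -> R) :
  (forall s t, A s -> A t -> `|f s - f t| <= `|s - t|) -> {within A, continuous f}.
Proof.
move=> hf; apply/subspace_continuousP => t At; apply/cvgrPdist_lt => e e0.
apply/nbhs_ballP; exists e => //= s; rewrite /ball/= => st As.
exact: le_lt_trans (hf _ _ At As) st.
Qed.

(** The Lipschitz bound provides the continuity that upgrades midpoint convexity to convexity. *)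
Lemma midpoint_convex {R : realType} (f : R -> R) (l : R) :
  (forall s t, 0 <= s <= l -> 0 <= t <= l -> `|f s - f t| <= `|s - t|) ->
  (forall s t, 0 <= s -> s <= t -> t <= l -> 2 * f ((s + t) / 2) <= f s + f t) ->
  forall t, 0 <= t <= l -> l * f t <= (l - t) * f 0 + t * f l.
Proof.
move=> lip mid t ht.
suff small (e : R) : 0 < e -> l * f t <= (l - t) * f 0 + t * f l + e * l ^+ 2.
  rewrite leNgt; apply/negP => lt; have l2 : 0 <= l ^+ 2 by rewrite sqr_ge0.
  have [D DE] : exists D, D = l * f t - ((l - t) * f 0 + t * f l) by eexists.
  have D0 : 0 < D by rewrite DE subr_gt0.
  have l1 : 0 < l ^+ 2 + 1 by lra.
  have := small (D / (l ^+ 2 + 1) / 2); rewrite !divr_gt0// => /(_ isT).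
  have -> : D / (l ^+ 2 + 1) / 2 * l ^+ 2 = D / 2 - D / (l ^+ 2 + 1) / 2.
    by field; rewrite gt_eqF.
  have : 0 < D / (l ^+ 2 + 1) / 2 by rewrite !divr_gt0.
  by move: (D / _ / 2) => z; lra.
move=> e0; have l0 : 0 <= l by lra.
(* The deviation from the chord plus a strictly convex perturbation. An interior maximum [c] is
   impossible: the midpoint inequality on [[c - d, c + d]] makes the second difference of [h] at
   least [2 * (e * d ^+ 2)]. *)
pose h s := l * f s - ((l - s) * f 0 + s * f l) + e * s ^+ 2.
have cf : {within `[0, l], continuous f}.
  by apply: lipschitz_within_continuous => u v; rewrite /= !in_itv/=; exact: lip.
have ci : {within `[0, l], continuous (fun s : R => s)}.
  by apply: continuous_subspaceT => s; exact: cvg_id.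
have cq : {within `[0, l], continuous (fun s : R => s ^+ 2)}.
  by apply: continuous_subspaceT => s; exact: exprn_continuous.
have ch : {within `[0, l], continuous h}.
  move=> s; apply: cvgD; last by apply: cvgM; [exact: cvg_cst|exact: cq].
  apply: cvgB; first by apply: cvgM; [exact: cvg_cst|exact: cf].
  apply: cvgD; apply: cvgM; try exact: cvg_cst; last exact: ci.
  by apply: cvgB; [exact: cvg_cst|exact: ci].
have [c] := EVT_max l0 ch; rewrite in_itv/= => hc hmax.
have h0 : h 0 = 0 by rewrite /h; ring.
have hl : h l = e * l ^+ 2 by rewrite /h; ring.
suff hcl : h c <= e * l ^+ 2.
  have : h t <= h c by apply: hmax; rewrite in_itv.
  by rewrite {1}/h; have := mulr_ge0 (ltW e0) (sqr_ge0 t); lra.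
have [->|c0] := eqVneq c 0; first by rewrite h0 mulr_ge0 ?sqr_ge0// ltW.
have [->|cl] := eqVneq c l; first by rewrite hl.
have c1 : 0 < c by rewrite lt_neqAle eq_sym c0; case/andP: hc.
have c2 : c < l by rewrite lt_neqAle cl; case/andP: hc.
pose d := Num.min c (l - c).
have d0 : 0 < d by rewrite lt_min c1 subr_gt0.
have dc : d <= c by rewrite ge_min lexx.
have dl : d <= l - c by rewrite ge_min lexx orbT.
have := mid (c - d) (c + d); have -> : (c - d + (c + d)) / 2 = c by field.
have hm1 : h (c - d) <= h c by apply: hmax; rewrite in_itv/=; lra.
have hm2 : h (c + d) <= h c by apply: hmax; rewrite in_itv/=; lra.
have ed : 0 < e * d ^+ 2 by rewrite mulr_gt0 ?exprn_gt0.
have hs : h (c - d) + h (c + d) - 2 * h c =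
  l * (f (c - d) + f (c + d) - 2 * f c) + 2 * (e * d ^+ 2) by rewrite /h; ring.
move=> /(_ _ _ _) m; have : 0 <= l * (f (c - d) + f (c + d) - 2 * f c).
  by rewrite mulr_ge0// subr_ge0 m//; lra_from dc d0 dl.
by lra.
Qed.

(** Error bookkeeping for [tiny_hinge]: the two factors [1 + n] come from the bounds on [gsin], the
    factor [1 - n] from the growth of [gver]. *)
Lemma hinge_coefficient {R : realType} (n e E : R) : 0 < n -> n <= 1 / 16 -> n <= e / 16 ->
  0 < e -> -1 <= E <= 1 -> (1 - E) * (1 + n) ^+ 2 <= (1 - n) * (1 - E + e).
Proof.
move=> n0 n1 ne e0 hE.
have nn : n ^+ 2 <= n / 16 by rewrite expr2 ler_pM2l//; lra.
have h1 : (1 - E) * ((1 + n) ^+ 2 - (1 - n)) <= 2 * (4 * n).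
  by rewrite ler_pM//; have := sqr_ge0 n; lra.
have h2 : n * e <= 1 / 16 * e by rewrite ler_wpM2r// ltW.
by lra.
Qed.

Section tiny_ball_geometry.
Context {R : realType} {X : metricType R} (kappa : R) (x0 : X) (r0 : R).
Hypothesis hU : tiny_ball kappa x0 r0.
Implicit Types (x y z p q r : X) (s t : R).

Local Notation W := (closed_mball x0 (10 * r0)).
Local Notation sn := (gsin kappa).
Local Notation ver := (gver kappa).
Local Notation cs := (gcos kappa).

Lemma mdist_lip x y z : `|mdist x z - mdist y z| <= mdist x y.
Proof.
have := metric_triangle x y z; have := metric_triangle y x z.
by rewrite (metric_sym y x) ler_norml => ? ?; apply/andP; split; lra.
Qed.

Lemma geodesic_within_mdist p q g s t : geodesic_within W p q g ->
  0 <= s <= mdist p q -> 0 <= t <= mdist p q -> mdist (g s) (g t) = `|s - t|.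
Proof. by move=> [[gg _ _] _] hs ht; apply: gg; rewrite /= in_itv. Qed.

Lemma geodesic_within_sub p q g s t : geodesic_within W p q g ->
  0 <= s -> s <= t -> t <= mdist p q -> geodesic_within W (g s) (g t) (fun u => g (s + u)).
Proof.
move=> hg s0 st tl; have d : mdist (g s) (g t) = t - s.
  by rewrite (geodesic_within_mdist hg); [rewrite distrC ger0_norm ?subr_ge0|lra|lra].
rewrite /geodesic_within /geodesic_between d; split.
  split; [|by rewrite addr0|by rewrite addrC subrK].
  move=> u v; rewrite /= !in_itv/= => hu hv; rewrite (geodesic_within_mdist hg); [|lra|lra].
  by congr `|_|; ring.
by move=> u; rewrite /= in_itv/= => hu; case: hg => _; apply; rewrite /= in_itv/=; lra.
Qed.

(** For [kappa = 1] the vertex comparison at the midpoint gives [cos d * cos (l / 2) >= cos ((a + b)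
    / 2) * cos ((a - b) / 2)]. Since [|a - b| <= l] and [cos ((a + b) / 2) > 0], the right side is
    at least [cos ((a + b) / 2) * cos (l / 2)]. *)
Lemma tiny_midpoint p q r (g : R -> X) : W p -> W q -> W r -> geodesic_within W p q g ->
  2 * mdist (g (mdist p q / 2)) r <= mdist p r + mdist q r.
Proof.
move=> hp hq hr hg; have r00 := tiny_radius_gt0 hU.
have l20 := mdist_tiny hp hq; have b20 := mdist_tiny hp hr.
have a20 := mdist_tiny hq hr; have l0 := mdist_ge0 p q; have b0 := mdist_ge0 p r.
have a0 := mdist_ge0 q r.
have [lz|ln0] := eqVneq (mdist p q) 0.
  have pq := mdist_positivity _ _ lz; rewrite lz mul0r.
  by have -> : g 0 = p; [by case: hg => -[]|rewrite -pq; lra].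
have Wm : W (g (mdist p q / 2)) by case: hg => _; apply; rewrite /= in_itv/=; lra.
have d20 := mdist_tiny Wm hr; have d0 := mdist_ge0 (g (mdist p q / 2)) r.
have tri1 := metric_triangle q p r; have tri2 := metric_triangle p q r.
rewrite (metric_sym q p) in tri1.
have := tiny_vertex_comparison hU hp hq hr hg (s := mdist p q / 2) ltac:(lra).
set l := mdist p q in l20 l0 tri1 tri2 ln0 *; set a := mdist q r in a20 a0 tri1 tri2 *.
set b := mdist p r in b20 b0 tri1 tri2 *; set d := mdist (g _) r in d20 d0 *.
have lp : 0 < l by rewrite lt_neqAle eq_sym ln0.
have s2 : 0 < sn (l / 2) by apply: (tiny_gsin_gt0 hU); lra.
have c2 : 0 < cs (l / 2) by apply: (tiny_gcos_gt0 hU); rewrite ger0_norm; lra.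
have cS : 0 < cs ((a + b) / 2) by apply: (tiny_gcos_gt0 hU); rewrite ger0_norm; lra.
have -> : l - l / 2 = l / 2 by field.
have {1}-> : l = l / 2 + l / 2 by field.
have aE : a = (a + b) / 2 + (a - b) / 2 by field.
have bE : b = (a + b) / 2 - (a - b) / 2 by field.
have abE : ver a + ver b = 2 * (ver ((a + b) / 2) + ver ((a - b) / 2) -
    kappa * ver ((a + b) / 2) * ver ((a - b) / 2)).
  by rewrite [in LHS]aE [X in _ + ver X]bE gverD gverB; ring.
have dM : ver ((a - b) / 2) <= ver (l / 2).
  have [ab|ba] := leP b a.
    by rewrite (tiny_gver_mono hU) ?in_itv/=; lra_from hU r00 ab a20 b0 l20 l0 tri1 tri2.
  by rewrite -gverN (tiny_gver_mono hU) ?in_itv/=; lra_from hU r00 ba b20 a0 l20 l0 tri1 tri2.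
move=> V; suff : ver d <= ver ((a + b) / 2).
  by rewrite (tiny_gver_mono hU) ?in_itv/=; lra_from hU r00 d0 d20 a0 b0 a20 b20.
rewrite gsinD in V.
have V1 : ver d * cs (l / 2) * (2 * sn (l / 2)) <=
    ((ver a + ver b) / 2 - ver (l / 2)) * (2 * sn (l / 2)) by lra.
rewrite ler_pM2r ?mulr_gt0// abE in V1.
rewrite -(ler_pM2r c2) (le_trans V1)//.
have -> : (2 * (ver ((a + b) / 2) + ver ((a - b) / 2) -
     kappa * ver ((a + b) / 2) * ver ((a - b) / 2)) / 2 - ver (l / 2)) =
  ver ((a + b) / 2) * cs (l / 2) + (ver ((a - b) / 2) - ver (l / 2)) * cs ((a + b) / 2).
  by rewrite /gcos; field.
by rewrite gerDl mulr_le0_ge0 ?(ltW cS)// subr_le0.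
Qed.

Lemma tiny_convex p q r (g : R -> X) t : W p -> W q -> W r -> geodesic_within W p q g ->
  0 <= t <= mdist p q ->
  mdist p q * mdist (g t) r <= (mdist p q - t) * mdist p r + t * mdist q r.
Proof.
move=> hp hq hr hg ht; have [[_ g0 gl] gW] := hg.
have Wg u : 0 <= u <= mdist p q -> W (g u) by move=> hu; apply: gW; rewrite /= in_itv.
have lip s u : 0 <= s <= mdist p q -> 0 <= u <= mdist p q ->
    `|mdist (g s) r - mdist (g u) r| <= `|s - u|.
  by move=> hs hu; rewrite -(geodesic_within_mdist hg hs hu); exact: mdist_lip.
have mid s u : 0 <= s -> s <= u -> u <= mdist p q ->
    2 * mdist (g ((s + u) / 2)) r <= mdist (g s) r + mdist (g u) r.
  move=> s0 su ul; have hs : 0 <= s <= mdist p q by lra.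
  have hu : 0 <= u <= mdist p q by lra.
  have := tiny_midpoint (Wg s hs) (Wg u hu) hr (geodesic_within_sub hg s0 su ul).
  rewrite (geodesic_within_mdist hg)// distrC ger0_norm ?subr_ge0//.
  by have -> : s + (u - s) / 2 = (s + u) / 2 by field.
have := midpoint_convex lip mid ht; rewrite g0 gl.
exact.
Qed.

(** A quantitative form of uniqueness: the right side of the vertex comparison vanishes when [r] has
    distances [s] and [mdist p q - s] from the ends, and [ver] is continuous. *)
Lemma tiny_geodesic_stable p q (g : R -> X) s (e : R) :
  W p -> W q -> geodesic_within W p q g -> 0 <= s <= mdist p q -> 0 < e ->
  exists2 d : R, 0 < d & forall r, W r -> mdist p r < s + d ->
    mdist r q < mdist p q - s + d -> mdist (g s) r < e.
Proof.
move=> hp hq hg hs e0; have r00 := tiny_radius_gt0 hU.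
have [[gg g0 gl] gW] := hg.
have [s0|sn0] := eqVneq s 0.
  exists e => // r hr; rewrite s0 g0 add0r; lra.
have [sl|snl] := eqVneq s (mdist p q).
  by exists e => // r hr _; rewrite sl gl subrr add0r metric_sym.
have s1 : 0 < s by rewrite lt_neqAle eq_sym sn0; case/andP: hs.
have s2 : s < mdist p q by rewrite lt_neqAle snl; case/andP: hs.
have l20 := mdist_tiny hp hq.
pose e1 := Num.min e (20 * r0).
have e10 : 0 < e1 by rewrite lt_min e0 mulr_gt0.
have e1r : e1 <= 20 * r0 by rewrite ge_min lexx orbT.
have ve : 0 < ver e1.
  by rewrite -(gver0 kappa) ltNge (tiny_gver_mono hU) ?in_itv/= -?ltNge ?ge_min ?lexx ?orbT//; lra.
have sl : 0 < sn (mdist p q) by apply: (tiny_gsin_gt0 hU); lra.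
have sA : 0 < sn (mdist p q - s) by apply: (tiny_gsin_gt0 hU); lra.
have sB : 0 < sn s by apply: (tiny_gsin_gt0 hU); lra.
(* Chosen so that errors below [e2] in both versines add up to less than [ver e1 * sn (mdist p q)];
   the cap on [e1] keeps it where [ver] is monotone. *)
pose e2 := ver e1 * sn (mdist p q) / (sn (mdist p q - s) + sn s).
have e20 : 0 < e2 by rewrite divr_gt0 ?mulr_gt0 ?addr_gt0.
have near_ver u : exists2 d : R, 0 < d & forall v, `|v - u| < d -> ver v - ver u < e2.
  have /cvgrPdist_lt/(_ _ e20)/nbhs_ballP[d /= d0 hd] := @continuous_gver R kappa u.
  exists d => // v vu; have := hd v; rewrite /ball/= distrC => /(_ vu).
  by rewrite distrC; exact: le_lt_trans (ler_norm _).
have [d1 d10 hd1] := near_ver s; have [d2 d20 hd2] := near_ver (mdist p q - s).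
exists (Num.min d1 d2); first by rewrite lt_min d10.
move=> r hr; rewrite (metric_sym r q) -!ltrBlDl !lt_min => /andP[b1 b2] /andP[a1 a2].
have tri := metric_triangle p r q; rewrite (metric_sym r q) in tri.
have Wg : W (g s) by apply: gW; rewrite /= in_itv.
have V := tiny_vertex_comparison hU hp hq hr hg hs.
have vb : ver (mdist p r) - ver s < e2 by apply: hd1; rewrite ltr_norml; apply/andP; split; lra.
have va : ver (mdist q r) - ver (mdist p q - s) < e2.
  by apply: hd2; rewrite ltr_norml; apply/andP; split; lra.
suff : mdist (g s) r < e1 by rewrite lt_min => /andP[].
have dg := mdist_tiny Wg hr; have dg0 := mdist_ge0 (g s) r.
rewrite ltNge -(tiny_gver_mono hU) ?in_itv/= -?ltNge ?ge_min ?lexx ?orbT//; last first.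
- by rewrite dg0/=; lra.
- by rewrite (ltW e10)/=; lra.
rewrite -(ltr_pM2r sl) (le_lt_trans V)//.
have -> : ver e1 * sn (mdist p q) = sn (mdist p q - s) * e2 + sn s * e2.
  by rewrite /e2; field; rewrite gt_eqF// addr_gt0.
by rewrite ltrD// ltr_pM2l.
Qed.

Lemma tiny_geodesic_unique p q r (g : R -> X) s :
  W p -> W q -> W r -> geodesic_within W p q g -> 0 <= s <= mdist p q ->
  mdist p r = s -> mdist r q = mdist p q - s -> g s = r.
Proof.
move=> hp hq hr hg hs e1 e2; apply: mdist_positivity; apply/eqP.
rewrite eq_le mdist_ge0 andbT leNgt; apply/negP => d0.
have [d dp hd] := tiny_geodesic_stable hp hq hg hs d0.
by have := hd r hr; rewrite e1 e2 !ltrDl ltxx => /(_ dp dp).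
Qed.

(* The conclusion says that the cosine of the Euclidean comparison angle at [x] is
   at least [E - e], where [E] is a rate of decrease of the distance to [c]. *)
Lemma tiny_hinge x c (h : R -> X) (e : R) :
  W x -> W c -> geodesic_within W x c h -> 0 < mdist x c -> 0 < e ->
  exists2 d : R, 0 < d & forall q s t E, W q -> -1 <= E <= 1 ->
    0 < s < d -> 0 < t < d -> mdist x q = t -> mdist q c <= mdist x c - E * t ->
    mdist q (h s) ^+ 2 <= s ^+ 2 + t ^+ 2 - 2 * s * t * (E - e).
Proof.
move=> hx hc hh l0 e0; have r00 := tiny_radius_gt0 hU.
pose n := Num.min e 1 / 16.
have n0 : 0 < n by rewrite divr_gt0// lt_min e0 ltr01.
have n1 : n <= 1 / 16 by rewrite ler_pM2r// ge_min lexx orbT.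
have ne : n <= e / 16 by rewrite ler_pM2r// ge_min lexx.
have [d1 d10 hd1] := gsin_lip_near0 kappa n0.
have [d2 d20 hd2] := gver_growth_near0 kappa n0.
have l20 := mdist_tiny hx hc.
pose d := Num.min (Num.min (d1 / 2) (d2 / 2)) (mdist x c / 2).
exists d; first by rewrite !lt_min !divr_gt0.
move=> q s t E hq hE; rewrite !lt_min => /andP[s0 /andP[/andP[sd1 sd2] sl]].
move=> /andP[t0 /andP[/andP[td1 td2] tl]] xq qc.
have hs : 0 <= s <= mdist x c by lra.
have V := tiny_vertex_comparison hU hx hc hq hh hs.
have Et : `|E * t| <= t.
  by rewrite normrM (gtr0_norm t0) ler_piMl ?(ltW t0)// ler_norml.
have [Et1 Et2] : - t <= E * t /\ E * t <= t by move: Et; rewrite ler_norml => /andP[].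
have s1 : 0 < sn s by apply: (tiny_gsin_gt0 hU); lra.
have sl1 : 0 < sn (mdist x c) by apply: (tiny_gsin_gt0 hU); lra.
have Wh : W (h s) by case: hh => _; apply; rewrite /= in_itv.
have xh : mdist x (h s) = s.
  have [[_ h0 _] _] := hh; rewrite -{1}h0 (geodesic_within_mdist hh) ?sub0r ?normrN ?gtr0_norm//.
  by lra.
have dge : `|s - t| <= mdist (h s) q.
  rewrite -{1}xh -xq (metric_sym x q) (metric_sym x (h s)); exact: mdist_lip.
have dle : mdist (h s) q <= s + t.
  by have := metric_triangle (h s) x q; rewrite (metric_sym (h s) x) xh xq.
have va : ver (mdist c q) <= ver (mdist x c - E * t).
  by rewrite (tiny_gver_mono hU) ?in_itv/= ?mdist_ge0 ?(metric_sym c q)//;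
    lra_from hU r00 l0 l20 qc Et1 Et2 tl t0.
have vE : ver (E * t) <= ver t.
  have <- : ver `|E * t| = ver (E * t) by case: ger0P => // _; rewrite gverN.
  by rewrite (tiny_gver_mono hU) ?in_itv/= ?normr_ge0//; lra_from hU r00 Et t0 tl l20.
have cl : 0 < cs (mdist x c).
  by apply: (tiny_gcos_gt0 hU); rewrite ger0_norm; lra_from hU r00 l0 l20.
(* Replacing [mdist c q] by its bound [mdist x c - E * t] leaves a surplus
   [cs l * sn s * (ver t - ver (E * t))], with [l] the length of [xc], which is nonnegative because
   [|E| <= 1]. *)
have V2 : ver (mdist (h s) q) <= ver (s - t) + sn s * (sn t - sn (E * t)).
  rewrite -(ler_pM2r sl1); apply: le_trans V _.
  have -> : (ver (s - t) + sn s * (sn t - sn (E * t))) * sn (mdist x c) =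
      sn (mdist x c - s) * (ver t - ver s) +
      sn s * (ver (mdist x c - E * t) - ver (mdist x c - s)) +
      cs (mdist x c) * sn s * (ver t - ver (E * t)).
    rewrite !gsinB !gverB /gcos; have e1 := gsin_sqr kappa s.
    by ring: e1.
  have k1 : sn s * ver (mdist c q) <= sn s * ver (mdist x c - E * t).
    by rewrite ler_wpM2l// ltW.
  have k2 : 0 <= cs (mdist x c) * sn s * (ver t - ver (E * t)).
    by rewrite mulr_ge0 ?subr_ge0// mulr_ge0// ltW.
  by rewrite xq; lra_from hU k1 k2.
have sn_s : sn s <= (1 + n) * s.
  by have := hd1 0 s; rewrite gsin0 !subr0; apply; lra_from hU s0 sd1 d10.
have sn_t : sn t - sn (E * t) <= (1 + n) * (t - E * t).
  by apply: hd1; lra_from hU Et1 Et2 t0 td1 d10.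
(* Growth is measured from [|s - t|], so that the leading term [ver (s - t)] of [V2] cancels exactly
   and the error is relative to what remains. *)
have := hd2 `|s - t| (mdist (h s) q) (normr_ge0 _) dge
  ltac:(lra_from hU dle sd2 td2 d20).
have -> : ver `|s - t| = ver (s - t) by have [_|_] := ger0P (s - t); rewrite ?gverN.
rewrite real_normK ?num_real// (metric_sym q).
set D := mdist (h s) q ^+ 2 => growth.
have up : sn s * (sn t - sn (E * t)) <= (1 + n) * s * ((1 + n) * (t - E * t)).
  have u0 : 0 <= (1 + n) * (t - E * t) by rewrite mulr_ge0 ?subr_ge0//; lra_from hU n0 Et2.
  apply: le_trans (ler_wpM2l (ltW s1) sn_t) _.
  by rewrite ler_wpM2r.
have st0 : 0 < s * t by rewrite mulr_gt0.
have key : (1 - n) * (D - (s - t) ^+ 2) <= 2 * (s * t) * ((1 - E) * (1 + n) ^+ 2).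
  by lra_from hU growth up V2.
have coef := hinge_coefficient n0 n1 ne e0 hE.
have nlt : 0 < 1 - n by lra_from hU n1.
rewrite -(ler_pM2l nlt).
have k2 : 2 * (s * t) * ((1 - E) * (1 + n) ^+ 2) <= 2 * (s * t) * ((1 - n) * (1 - E + e)).
  by rewrite ler_wpM2l// mulr_ge0// ltW.
by lra_from hU key k2.
Qed.

End tiny_ball_geometry.

(** * Angles *)

Lemma cos_lip {R : realType} (a b : R) : `|cos a - cos b| <= `|a - b|.
Proof.
wlog ab : a b / a <= b => [h|].
  have [ab|/ltW ba] := leP a b; first exact: h.
  by rewrite distrC (distrC a); exact: h.
have [c _ e] := @MVT_segment _ cos (fun x => - sin x) a b ab (fun x _ => is_derive_cos x)
  (continuous_subspaceT (@continuous_cos R)).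
by rewrite distrC (distrC a) e normrM normrN ler_piMl// sin_max.
Qed.

(** The drop of the cosine over [[a, a + e]] is [2 * sin (a + e / 2) * sin (e / 2)], smallest when
    the interval touches 0 or [pi]. A bound free of [a] is what converts errors on cosines into
    errors on angles. *)
Lemma cos_gap {R : realType} (a e : R) : 0 <= a -> 0 <= e -> a + e <= pi ->
  1 - cos e <= cos a - cos (a + e).
Proof.
move=> a0 e0 ae.
have e2 : e = e / 2 + e / 2 by field.
have aE : a = (a + e / 2) - e / 2 by ring.
have aeE : a + e = (a + e / 2) + e / 2 by field.
have -> : cos a - cos (a + e) = 2 * sin (a + e / 2) * sin (e / 2).
  by rewrite {1}aE aeE cosB (cosD (a + e / 2)); ring.
have -> : 1 - cos e = 2 * sin (e / 2) * sin (e / 2).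
  have c2 := cos2sin2 (e / 2); rewrite {1}e2 cosD.
  by ring: c2.
have s0 : 0 <= sin (e / 2) by rewrite sin_ge0_pi//; lra.
rewrite ler_wpM2r// ler_wpM2l//.
have [h|h] := leP (a + e / 2) (pi / 2).
  by rewrite leNgt ltr_sin ?in_itv/= -?leNgt; lra.
have -> : sin (a + e / 2) = sin (pi - (a + e / 2)).
  by rewrite sinB sinpi cospi; ring.
by rewrite leNgt ltr_sin ?in_itv/= -?leNgt; lra.
Qed.

Lemma ler_cos {R : realType} : {in `[0, pi] &, {mono (@cos R) : a b /~ a <= b}}.
Proof. by move=> a b ha hb; rewrite !leNgt ltr_cos. Qed.

Lemma ltr_of_cos_gap {R : realType} (a b e : R) : 0 <= a -> 0 <= b <= pi -> 0 < e ->
  cos a - (1 - cos e) < cos b -> b < a + e.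
Proof.
move=> a0 hb e0 h; rewrite ltNge; apply/negP => ab.
have := @cos_gap R a e a0 (ltW e0); have -> : a + e <= pi by lra.
move=> /(_ isT); have : cos b <= cos (a + e).
  by rewrite ler_cos ?in_itv//=; lra.
lra.
Qed.

Section angles.
Context {R : realType} {X : metricType R}.
Implicit Types (x y z p q r : X) (s t a b : R).

Definition comparison_cos x y z : R :=
  (mdist x y ^+ 2 + mdist x z ^+ 2 - mdist y z ^+ 2) / (2 * mdist x y * mdist x z).

Lemma comparison_cos_itv x y z : -1 <= comparison_cos x y z <= 1.
Proof.
rewrite /comparison_cos; have a0 := mdist_ge0 x y; have b0 := mdist_ge0 x z.
have c0 := mdist_ge0 y z; have := metric_triangle x y z; have := metric_triangle x z y.
have := metric_triangle y x z; rewrite (metric_sym y x) (metric_sym z y).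
move: (mdist x y) (mdist x z) (mdist y z) a0 b0 c0 => a b c a0 b0 c0 t1 t2 t3.
have [->|an0] := eqVneq a 0; first by rewrite mulr0 mul0r invr0 mulr0; lra.
have [->|bn0] := eqVneq b 0; first by rewrite mulr0 invr0 mulr0; lra.
have ap : 0 < a by rewrite lt_neqAle eq_sym an0.
have bp : 0 < b by rewrite lt_neqAle eq_sym bn0.
have ab : 0 < 2 * a * b by rewrite !mulr_gt0.
have h1 : 0 <= (a + b - c) * (a + b + c) by rewrite mulr_ge0//; lra.
have h2 : 0 <= (c - (a - b)) * (c + (a - b)) by rewrite mulr_ge0//; lra.
by rewrite ler_pdivrMr// ler_pdivlMr//; apply/andP; split; nra.
Qed.

Lemma cos_comparison_angle x y z : cos (comparison_angle x y z) = comparison_cos x y z.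
Proof. by rewrite /comparison_angle acosK// in_itv/= comparison_cos_itv. Qed.

Lemma comparison_angle_itv x y z : 0 <= comparison_angle x y z <= pi.
Proof. by rewrite acos_ge0 ?acos_lepi ?comparison_cos_itv. Qed.

Lemma comparison_angle_sym x y z : comparison_angle x y z = comparison_angle x z y.
Proof.
rewrite /comparison_angle (metric_sym z y); congr (acos (_ / _)); ring.
Qed.

Lemma comparison_angle_le x y z (c : R) : 0 < mdist x y -> 0 < mdist x z -> 0 <= c <= pi ->
  mdist y z ^+ 2 <= mdist x y ^+ 2 + mdist x z ^+ 2 - 2 * mdist x y * mdist x z * cos c ->
  comparison_angle x y z <= c.
Proof.
move=> a0 b0 hc h; have ab : 0 < 2 * mdist x y * mdist x z by rewrite !mulr_gt0.
rewrite -ler_cos ?in_itv//= ?comparison_angle_itv//.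
by rewrite cos_comparison_angle ler_pdivlMr//; lra.
Qed.

Lemma mdist_sqr_le x y z (c : R) : 0 < mdist x y -> 0 < mdist x z -> 0 <= c <= pi ->
  comparison_angle x y z <= c ->
  mdist y z ^+ 2 <= mdist x y ^+ 2 + mdist x z ^+ 2 - 2 * mdist x y * mdist x z * cos c.
Proof.
move=> a0 b0 hc h; have ab : 0 < 2 * mdist x y * mdist x z by rewrite !mulr_gt0.
move: h; rewrite -ler_cos ?in_itv//= ?comparison_angle_itv//.
by rewrite cos_comparison_angle ler_pdivlMr//; lra.
Qed.

Context {x : X}.
Implicit Types (f g h : geodesic_from x).

Let angle_lim g h := limf_esup
  (fun st : R * R => (comparison_angle x (g st.1) (h st.2))%:E) (filter_prod 0^'+ 0^'+).

(** Comparison angles lie in [[0, pi]], so the upper limit is finite and [fine] loses nothing. *)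
Lemma angle_limE g h : angle_lim g h = (angle g h)%:E.
Proof.
rewrite /angle -/(angle_lim g h) fineK// fin_real//; apply/andP; split.
  apply: (@lt_le_trans _ _ 0%E); first by rewrite ltNyr.
  apply: le_ereal_inf_tmp => _ [V FV <-].
  have [st Vst] := @filter_ex _ _ _ V FV.
  apply: le_trans (ereal_sup_ubound _); last by exists st.
  by rewrite lee_fin; case/andP: (comparison_angle_itv x (g st.1) (h st.2)).
apply: (@le_lt_trans _ _ (pi : R)%:E); last by rewrite ltry.
apply: ge_ereal_inf; exists (ereal_sup ((fun st : R * R =>
  (comparison_angle x (g st.1) (h st.2))%:E) @` setT)); first by exists setT => //; exact: filterT.
apply: ge_ereal_sup => _ [st _ <-]; rewrite lee_fin.
by case/andP: (comparison_angle_itv x (g st.1) (h st.2)).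
Qed.

Lemma angle_lt g h (c : R) : angle g h < c ->
  exists2 d : R, 0 < d & forall s t, 0 < s < d -> 0 < t < d ->
    comparison_angle x (g s) (h t) < c.
Proof.
rewrite -lte_fin -angle_limE => /ereal_inf_lt[_ [V [[A B] /= [A0 B0] AB] <-]] supV.
have [d1 /= d10 hd1] := A0; have [d2 /= d20 hd2] := B0.
exists (Num.min d1 d2); first by rewrite lt_min d10.
move=> s t; rewrite !lt_min => /andP[s0 /andP[s1 s2]] /andP[t0 /andP[t1 t2]].
rewrite -lte_fin; apply: le_lt_trans supV; apply: ereal_sup_ubound; exists (s, t) => //.
apply: AB; split => /=.
  by apply: hd1 => //=; rewrite sub0r normrN gtr0_norm.
by apply: hd2 => //=; rewrite sub0r normrN gtr0_norm.
Qed.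

Lemma angle_le g h (c d : R) : 0 < d ->
  (forall s t, 0 < s < d -> 0 < t < d -> comparison_angle x (g s) (h t) <= c) ->
  angle g h <= c.
Proof.
move=> d0 hd; rewrite -lee_fin -angle_limE.
pose V := [set st : R * R | 0 < st.1 < d /\ 0 < st.2 < d].
apply: ge_ereal_inf; exists (ereal_sup ((fun st : R * R =>
  (comparison_angle x (g st.1) (h st.2))%:E) @` V)).
  exists V => //; have near0 : 0^'+ [set s : R | 0 < s < d].
    near=> s; apply/andP; split; first by near: s; exact: nbhs_right_gt.
    by near: s; exact: nbhs_right_lt.
  by exists ([set s | 0 < s < d], [set s | 0 < s < d]).
by apply: ge_ereal_sup => _ [st [s1 s2] <-]; rewrite lee_fin hd.
Unshelve. all: by end_near. Qed.

Lemma angle_itv g h : 0 <= angle g h <= pi.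
Proof.
apply/andP; split; last first.
  apply: (@angle_le _ _ _ 1) => // s t _ _.
  by case/andP: (comparison_angle_itv x (g s) (h t)).
rewrite leNgt; apply/negP => /angle_lt[d d0 /(_ (d / 2) (d / 2))].
have -> : 0 < d / 2 < d by lra.
move=> /(_ isT isT); rewrite ltNge.
by case/andP: (comparison_angle_itv x (g (d / 2)) (h (d / 2))) => ->.
Qed.

Lemma angle_sym g h : angle g h = angle h g.
Proof.
suff le f1 f2 : angle f1 f2 <= angle f2 f1 by apply/eqP; rewrite eq_le !le.
apply/ler_addgt0Pr => e e0; have [d d0 hd] : exists2 d : R, 0 < d & forall s t,
    0 < s < d -> 0 < t < d -> comparison_angle x (f2 s) (f1 t) < angle f2 f1 + e.
  by apply: angle_lt; rewrite ltrDl.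
by apply: (angle_le d0) => s t hs ht; rewrite comparison_angle_sym ltW// hd.
Qed.

Lemma mdist_geo g s : 0 <= s <= geo_len g -> mdist x (g s) = s.
Proof.
move=> hs; rewrite -{1}(geo_start g) (geo_geodesic (g := g)) ?sub0r ?normrN ?ger0_norm//.
- by case/andP: hs.
- by rewrite /= in_itv/= lexx ltW// geo_len_gt0.
Qed.

Lemma angle_germ g h (d : R) : 0 < d -> (forall t, 0 <= t <= d -> g t = h t) -> angle g h = 0.
Proof.
move=> d0 gh; apply/eqP; rewrite eq_le; case/andP: (angle_itv g h) => -> _; rewrite andbT.
have lg := geo_len_gt0 g.
apply: (@angle_le _ _ _ (Num.min d (geo_len g))); first by rewrite lt_min d0.
move=> s t; rewrite !lt_min => /andP[s0 /andP[s1 s2]] /andP[t0 /andP[t1 t2]].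
by rewrite -gh ?comparison_angle_geodesic//; lra.
Qed.

Lemma angle_opposite g h (d : R) : 0 < d ->
  (forall t, 0 < t < d -> mdist (g t) (h t) = 2 * t) -> angle g h = pi.
Proof.
move=> d0 gh; apply/eqP; rewrite eq_le; case/andP: (angle_itv g h) => _ -> /=.
rewrite leNgt; apply/negP => /angle_lt[e e0 he].
have lg := geo_len_gt0 g; have lh := geo_len_gt0 h.
pose t := Num.min (Num.min d e) (Num.min (geo_len g) (geo_len h)) / 2.
have t0 : 0 < t by rewrite divr_gt0// !lt_min d0 e0 lg.
have : t + t <= Num.min (Num.min d e) (Num.min (geo_len g) (geo_len h)) by rewrite /t; lra.
rewrite !le_min => /andP[/andP[td te] /andP[tg th]].
have := he t t ltac:(lra) ltac:(lra).
rewrite ltNge /comparison_angle !mdist_geo ?gh; [|lra|lra|lra].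
rewrite (_ : _ / _ = -1) ?acosN1 ?lexx//.
by field; rewrite gt_eqF.
Qed.

(* The planar triangle with sides [s], [t] and angle [a + b] is cut by the ray
   at angle [a] from the first side in a point at distance [r] from the apex,
   where [r = s t sin (a + b) / (s sin a + t sin b)]. *)
Lemma angle_triangle f g h : angle f h <= angle f g + angle g h.
Proof.
have [big|small] := leP pi (angle f g + angle g h).
  by apply: le_trans big; case/andP: (angle_itv f h).
apply/ler_addgt0Pr => e e0.
(* A third of the gap to [pi], so that [a + b] stays below [pi] and the ray at angle [a] meets the
   opposite side. *)
pose e1 := Num.min (e / 2) ((pi - (angle f g + angle g h)) / 3).
have e10 : 0 < e1 by rewrite lt_min; apply/andP; split; lra.
have e1e : e1 <= e / 2 by rewrite ge_min lexx.
have e1p : e1 <= (pi - (angle f g + angle g h)) / 3 by rewrite ge_min lexx orbT.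
case/andP: (angle_itv f g) => fg0 _; case/andP: (angle_itv g h) => gh0 _.
pose a := angle f g + e1; pose b := angle g h + e1.
have [d1 d10 hd1] : exists2 d : R, 0 < d & forall s t, 0 < s < d -> 0 < t < d ->
  comparison_angle x (f s) (g t) < a by apply: angle_lt; rewrite ltrDl.
have [d2 d20 hd2] : exists2 d : R, 0 < d & forall s t, 0 < s < d -> 0 < t < d ->
  comparison_angle x (g s) (h t) < b by apply: angle_lt; rewrite ltrDl.
have lf := geo_len_gt0 f; have lg := geo_len_gt0 g; have lh := geo_len_gt0 h.
suff : angle f h <= a + b by rewrite /a /b; lra.
have a0 : 0 < a by rewrite /a; lra.
have b0 : 0 < b by rewrite /b; lra.
have abp : a + b < pi by rewrite /a /b; lra.
clearbody a b; clear e1p e1e e10.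
pose d := Num.min (Num.min d1 d2) (Num.min (geo_len f) (Num.min (geo_len g) (geo_len h))).
have d0 : 0 < d by rewrite !lt_min d10 d20 lf lg lh.
apply: (angle_le d0) => s t hs ht.
have sa : 0 < sin a by rewrite sin_gt0_pi//; lra.
have sb : 0 < sin b by rewrite sin_gt0_pi//; lra.
have sab : 0 < sin (a + b) by rewrite sin_gt0_pi//; lra.
have s0 : 0 < s by case/andP: hs.
have t0 : 0 < t by case/andP: ht.
pose D := s * sin a + t * sin b.
have D0 : 0 < D by rewrite addr_gt0 ?mulr_gt0.
pose r := s * t * sin (a + b) / D.
have r0 : 0 < r by rewrite divr_gt0 ?mulr_gt0.
have rd : r < d.
  apply: (@le_lt_trans _ _ (Num.max s t)).
    rewrite ler_pdivrMr// sinD.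
    have ms : s <= Num.max s t by rewrite le_max lexx.
    have mt : t <= Num.max s t by rewrite le_max lexx orbT.
    have h1 : s * sin a * (t * cos b) <= s * sin a * Num.max s t.
      rewrite ler_wpM2l ?mulr_ge0 ?(ltW s0) ?(ltW sa)//.
      by apply: le_trans mt; rewrite ler_piMr ?cos_le1// ltW.
    have h2 : t * sin b * (s * cos a) <= t * sin b * Num.max s t.
      rewrite ler_wpM2l ?mulr_ge0 ?(ltW t0) ?(ltW sb)//.
      by apply: le_trans ms; rewrite ler_piMr ?cos_le1// ltW.
    by rewrite /D; lra.
  by rewrite gt_max; case/andP: hs => _ ->; case/andP: ht.
have lt_d u : u < d -> [/\ u < d1, u < d2, u < geo_len f, u < geo_len g & u < geo_len h].
  by rewrite !lt_min => /andP[/andP[-> ->] /and3P[-> -> ->]].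
have [s1 s2 s3 s4 s5] := lt_d s ltac:(by case/andP: hs).
have [t1 t2 t3 t4 t5] := lt_d t ltac:(by case/andP: ht).
have [r1 r2 r3 r4 r5] := lt_d r rd.
have ds : mdist x (f s) = s by apply: mdist_geo; lra_from x s0 s3.
have dr : mdist x (g r) = r by apply: mdist_geo; lra_from x r0 r4.
have dt : mdist x (h t) = t by apply: mdist_geo; lra_from x t0 t5.
have fgr : mdist (f s) (g r) ^+ 2 <= s ^+ 2 + r ^+ 2 - 2 * s * r * cos a.
  have := @mdist_sqr_le x (f s) (g r) a; rewrite ds dr; apply; rewrite ?s0 ?r0//.
    by lra_from x a0 b0 abp.
  by rewrite ltW// hd1 ?s0 ?r0.
have grh : mdist (g r) (h t) ^+ 2 <= r ^+ 2 + t ^+ 2 - 2 * r * t * cos b.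
  have := @mdist_sqr_le x (g r) (h t) b; rewrite dr dt; apply; rewrite ?t0 ?r0//.
    by lra_from x a0 b0 abp.
  by rewrite ltW// hd2 ?t0 ?r0.
apply: comparison_angle_le; rewrite ?ds ?dt//; first by lra_from x a0 b0 abp.
(* [N2] is the squared length of the third side of the planar triangle and [m] the ratio in which
   the ray divides it; [e1E] and [e2E] compute the two pieces. *)
pose N2 := s ^+ 2 + t ^+ 2 - 2 * s * t * cos (a + b).
pose m := s * sin a / D.
have m0 : 0 < m by rewrite divr_gt0 ?mulr_gt0.
have m1 : 0 < 1 - m.
  have -> : 1 - m = t * sin b / D by rewrite /m /D; field; rewrite gt_eqF.
  by rewrite divr_gt0 ?mulr_gt0.
have e1E : s ^+ 2 + r ^+ 2 - 2 * s * r * cos a = m ^+ 2 * N2.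
  have Dn0 : D != 0 by rewrite gt_eqF.
  apply: (mulfI (expf_neq0 2 Dn0)).
  have -> : D ^+ 2 * (s ^+ 2 + r ^+ 2 - 2 * s * r * cos a) =
    D ^+ 2 * s ^+ 2 + (s * t * sin (a + b)) ^+ 2 - 2 * s * (s * t * sin (a + b)) * D * cos a.
    by rewrite /r; field.
  have -> : D ^+ 2 * (m ^+ 2 * N2) = (s * sin a) ^+ 2 * N2 by rewrite /m; field.
  rewrite /N2 /D sinD cosD; have ca := cos2sin2 a; have cb := cos2sin2 b.
  by ring: ca cb.
have e2E : r ^+ 2 + t ^+ 2 - 2 * r * t * cos b = (1 - m) ^+ 2 * N2.
  have Dn0 : D != 0 by rewrite gt_eqF.
  apply: (mulfI (expf_neq0 2 Dn0)).
  have -> : D ^+ 2 * (r ^+ 2 + t ^+ 2 - 2 * r * t * cos b) =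
    D ^+ 2 * t ^+ 2 + (s * t * sin (a + b)) ^+ 2 - 2 * t * (s * t * sin (a + b)) * D * cos b.
    by rewrite /r; field.
  have -> : D ^+ 2 * ((1 - m) ^+ 2 * N2) = (t * sin b) ^+ 2 * N2.
    have -> : 1 - m = t * sin b / D by rewrite /m /D; field; rewrite gt_eqF.
    by field.
  rewrite /N2 /D sinD cosD; have ca := cos2sin2 a; have cb := cos2sin2 b.
  by ring: ca cb.
have N20 : 0 <= N2.
  have -> : N2 = (s - t) ^+ 2 + 2 * (s * t) * (1 - cos (a + b)) by rewrite /N2; ring.
  by rewrite addr_ge0 ?sqr_ge0// !mulr_ge0 ?subr_ge0 ?cos_le1// ltW.
have le_N u v : 0 <= u -> 0 < v -> u ^+ 2 <= v ^+ 2 * N2 -> u <= v * Num.sqrt N2.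
  move=> u0 v0; rewrite -{1}(sqr_sqrtr N20) -exprMn ler_pXn2r// nnegrE.
  by rewrite mulr_ge0 ?sqrtr_ge0 ?ltW.
have A1 := le_N _ _ (mdist_ge0 (f s) (g r)) m0; rewrite -e1E in A1.
have A2 := le_N _ _ (mdist_ge0 (g r) (h t)) m1; rewrite -e2E in A2.
have fht : mdist (f s) (h t) <= Num.sqrt N2.
  by have := metric_triangle (f s) (g r) (h t); have := A1 fgr; have := A2 grh;
    lra_from x.
rewrite -/N2 -(sqr_sqrtr N20) ler_pXn2r// nnegrE ?mdist_ge0 ?sqrtr_ge0//.
Qed.

End angles.

(** * Directions and first variation *)

Section directions.
Context {R : realType} {X : metricType R} {x : X}.
Implicit Types (g h : geodesic_from x) (u v w : directions x).

Lemma geo_dist g s t : 0 <= s <= geo_len g -> 0 <= t <= geo_len g ->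
  mdist (g s) (g t) = `|s - t|.
Proof. by move=> hs ht; apply: geo_geodesic; rewrite /= in_itv. Qed.

Lemma angle_dist g1 g2 h1 h2 :
  `|angle g1 h1 - angle g2 h2| <= angle g1 g2 + angle h1 h2.
Proof.
have := angle_triangle g1 g2 h1; have := angle_triangle g2 h2 h1.
have := angle_triangle g2 g1 h2; have := angle_triangle g1 h1 h2.
rewrite (angle_sym g2 g1) (angle_sym h2 h1) ler_norml => ? ? ? ?.
by apply/andP; split; lra.
Qed.

(** Every use of [dir_dist] rests on this, as [limn] is meaningful only for convergent sequences. *)
Lemma dir_dist_cvg v w : angle (v n) (w n) @[n --> \oo] --> dir_dist v w.
Proof.
suff : cvgn (fun n => angle (v n) (w n)) by [].
apply: cauchy_cvg; apply: cauchy_exP => e e0.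
have [N1 hN1] := @dir_cauchy _ _ _ v (e / 2) ltac:(lra).
have [N2 hN2] := @dir_cauchy _ _ _ w (e / 2) ltac:(lra).
pose N := maxn N1 N2; exists (angle (v N) (w N)).
exists N => // n /= Nn; rewrite /ball/=.
apply: le_lt_trans (angle_dist _ _ _ _) _.
have := hN1 N n (leq_maxl _ _) (leq_trans (leq_maxl _ _) Nn).
have := hN2 N n (leq_maxr _ _) (leq_trans (leq_maxr _ _) Nn).
by lra.
Qed.

Lemma dir_dist_near v w (e : R) : 0 < e -> exists N : nat, forall n, (N <= n)%N ->
  `|dir_dist v w - angle (v n) (w n)| < e.
Proof.
by move=> e0; have /cvgrPdist_lt/(_ e e0)[N _ hN] := @dir_dist_cvg v w; exists N.
Qed.

Lemma dir_dist_le v w (c : R) (N : nat) :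
  (forall n, (N <= n)%N -> angle (v n) (w n) <= c) -> dir_dist v w <= c.
Proof.
move=> h; apply/ler_addgt0Pr => e e0; have [M hM] := dir_dist_near v w e0.
have := hM (maxn M N) (leq_maxl _ _); have := h (maxn M N) (leq_maxr _ _).
by rewrite ltr_distl => ? /andP[_ ?]; lra.
Qed.

Lemma dir_distC v w : dir_dist v w = dir_dist w v.
Proof. by rewrite /dir_dist; congr (limn _); apply/funext => n; rewrite angle_sym. Qed.

Lemma dir_dist_itv v w : 0 <= dir_dist v w <= pi.
Proof.
apply/andP; split.
  apply/ler_addgt0Pr => e e0; have [N /(_ N (leqnn N))] := dir_dist_near v w e0.
  by rewrite ltr_distl => /andP[? _]; have := angle_itv (v N) (w N); lra.
by apply: (@dir_dist_le _ _ _ 0%N) => n _; case/andP: (angle_itv (v n) (w n)).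
Qed.

Lemma dir_dist_triangle u v w : dir_dist u w <= dir_dist u v + dir_dist v w.
Proof.
apply/ler_addgt0Pr => e e0; have e2 : 0 < e / 2 by lra.
have [N1 h1] := dir_dist_near u v e2; have [N2 h2] := dir_dist_near v w e2.
apply: (@dir_dist_le _ _ _ (maxn N1 N2)) => n; rewrite geq_max => /andP[n1 n2].
have := h1 n n1; have := h2 n n2; have := angle_triangle (u n) (v n) (w n).
by rewrite !ltr_distl => ? /andP[? ?] /andP[? ?]; lra.
Qed.

(** Equal directions need not be equal as Cauchy sequences; this is the substitution rule for
    them. *)
Lemma dir_dist_eq0 u v w : dir_dist v w = 0 -> dir_dist u v = dir_dist u w.
Proof.
move=> vw; apply/eqP; rewrite eq_le; apply/andP; split.
  by rewrite -[leRHS]addr0 -vw (dir_distC v w) dir_dist_triangle.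
by rewrite -[leRHS]addr0 -vw dir_dist_triangle.
Qed.

Lemma dir_dist_dir_of g h : dir_dist (dir_of g) (dir_of h) = angle g h.
Proof. by rewrite /dir_dist/=; exact: lim_cst. Qed.

(** The purely metric half: an angle is an upper limit of comparison angles, so for short sides the
    Euclidean law of cosines bounds the distance to [h s'], and the triangle inequality passes from
    [h s'] to [h s]. *)
Lemma first_variation_ge g h (s e : R) : 0 < s <= geo_len h -> 0 < e ->
  exists2 d : R, 0 < d & forall t, 0 < t < d ->
    t * (cos (angle g h) - e) <= s - mdist (g t) (h s).
Proof.
move=> hs e0; have e2 : 0 < e / 2 by lra.
have [d1 d10 hd1] : exists2 d : R, 0 < d & forall s t, 0 < s < d -> 0 < t < d ->
  comparison_angle x (g s) (h t) < angle g h + e / 2 by apply: angle_lt; rewrite ltrDl.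
have lg := geo_len_gt0 g.
pose s' := Num.min s (d1 / 2).
have s'0 : 0 < s' by rewrite lt_min; apply/andP; split; lra.
have s's : s' <= s by rewrite ge_min lexx.
have s'd : s' < d1 by apply: (@le_lt_trans _ _ (d1 / 2)); rewrite ?ge_min ?lexx ?orbT//; lra.
exists (Num.min (Num.min d1 (geo_len g)) (s' * e)); first by rewrite !lt_min d10 lg mulr_gt0.
move=> t; rewrite !lt_min => /andP[t0 /andP[/andP[t1 t2] t3]].
have dt : mdist x (g t) = t by apply: mdist_geo; lra.
have ds : mdist x (h s') = s' by apply: mdist_geo; lra.
have hss : mdist (h s') (h s) = s - s'.
  by rewrite geo_dist; [rewrite distrC ger0_norm ?subr_ge0|lra|lra].
have := hd1 t s' ltac:(lra) ltac:(lra); set al := comparison_angle _ _ _ => hal.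
have cos_al : cos (angle g h) - e / 2 <= cos al.
  have [ale|/ltW ale] := leP al (angle g h).
    have : cos (angle g h) <= cos al.
      by rewrite ler_cos ?in_itv//= ?angle_itv ?comparison_angle_itv.
    by lra.
  have := cos_lip (angle g h) al; rewrite (distrC (angle _ _)) (ger0_norm (x := al - _)) ?subr_ge0//.
  by rewrite ler_norml => /andP[_ ?]; lra.
have hq : mdist (g t) (h s') ^+ 2 <= t ^+ 2 + s' ^+ 2 - 2 * t * s' * cos al.
  have := @mdist_sqr_le _ _ x (g t) (h s') al; rewrite dt ds; apply; rewrite ?t0 ?lexx//.
  exact: comparison_angle_itv.
have tri := metric_triangle (g t) (h s') (h s).
suff : mdist (g t) (h s') <= s' - t * (cos (angle g h) - e) by lra.
(* Used instead of extracting a square root; the excess [t ^+ 2] is absorbed by [t < s' * e]. *)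
have am : 2 * s' * mdist (g t) (h s') <= s' ^+ 2 + mdist (g t) (h s') ^+ 2.
  by have := sqr_ge0 (s' - mdist (g t) (h s')); lra.
rewrite -(ler_pM2l (x := 2 * s')) ?mulr_gt0//.
have k1 : t * t <= t * (s' * e) by rewrite ler_wpM2l ?ltW.
have k2 : t * s' * (cos (angle g h) - e / 2) <= t * s' * cos al.
  by rewrite ler_wpM2l// mulr_ge0// ltW.
by lra.
Qed.

End directions.

(** * First variation and semicontinuity of angles in a tiny ball *)

Section tiny_ball_angles.
Context {R : realType} {X : metricType R} (kappa : R) (x0 : X) (r0 : R).
Hypothesis hU : tiny_ball kappa x0 r0.
Implicit Types (x y z p q r : X) (s t : R).

Local Notation W := (closed_mball x0 (10 * r0)).

Lemma geo_in_ball x (g : geodesic_from x) t : mdist x0 x + geo_len g <= 10 * r0 ->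
  0 <= t <= geo_len g -> W (g t).
Proof.
move=> hg ht; rewrite /closed_mball /=; have := metric_triangle x0 x (g t).
by rewrite (mdist_geo ht); lra.
Qed.

Lemma geo_within x (g : geodesic_from x) t : mdist x0 x + geo_len g <= 10 * r0 ->
  0 <= t <= geo_len g -> geodesic_within W x (g t) g.
Proof.
move=> hg ht; rewrite /geodesic_within /geodesic_between (mdist_geo ht); split.
  split=> //; last exact: geo_start.
  move=> u v; rewrite /= !in_itv/= => hu hv; apply: geo_dist; lra.
by move=> u; rewrite /= in_itv/= => hu; apply: geo_in_ball => //; lra.
Qed.

(** The half that uses curvature. Convexity of the distance to [h s] along [g] makes the average
    rate of decrease [E] on [[0, t]] a lower bound for the rate on every [[0, u]], and [tiny_hinge]
    turns this rate into a bound on comparison angles. *)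
Lemma first_variation_le x (g h : geodesic_from x) s t :
  mdist x0 x + geo_len g <= 10 * r0 -> mdist x0 x + geo_len h <= 10 * r0 ->
  0 < t <= geo_len g -> 0 < s <= geo_len h ->
  s - mdist (g t) (h s) <= t * cos (angle g h).
Proof.
move=> hg hh ht hs; have ht0 : 0 <= t <= geo_len g by lra.
have hs0 : 0 <= s <= geo_len h by lra.
have t0 : 0 < t by case/andP: ht.
have dt := mdist_geo ht0; have ds := mdist_geo hs0.
pose E := (s - mdist (g t) (h s)) / t.
have Et : E * t = s - mdist (g t) (h s) by rewrite /E divfK ?gt_eqF.
have hE : -1 <= E <= 1.
  have := metric_triangle x (g t) (h s); have := metric_triangle (g t) x (h s).
  rewrite (metric_sym (g t) x) dt ds => ? ?.
  by rewrite /E ler_pdivlMr// ler_pdivrMr//; lra.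
rewrite mulrC -Et ler_pM2r//; apply/ler_addgt0Pr => e e0.
have Wx : W x by rewrite /closed_mball /=; have := geo_len_gt0 g; lra.
have Wh := geo_in_ball hh hs0; have Wg := geo_in_ball hg ht0.
have xh0 : 0 < mdist x (h s) by rewrite ds; case/andP: hs.
have [d d0 hd] := tiny_hinge hU Wx Wh (geo_within hh hs0) xh0 e0.
(* Truncation at [-1] keeps the argument of [acos] in range; when it is active, the bound needed
   below is the triangle inequality. *)
pose c := acos (Num.max (-1) (E - e)).
have mE : -1 <= Num.max (-1) (E - e) <= 1 by rewrite le_max lexx/= ge_max; lra.
have cosc : cos c = Num.max (-1) (E - e) by rewrite acosK// in_itv.
have hc : 0 <= c <= pi by rewrite acos_ge0// acos_lepi.
suff : angle g h <= c.
  rewrite -ler_cos ?in_itv//= ?angle_itv// cosc => h1.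
  have : E - e <= Num.max (-1) (E - e) by rewrite le_max lexx orbT.
  lra.
apply: (@angle_le _ _ _ _ _ _ (Num.min d (Num.min t s))); first by rewrite !lt_min d0 t0; lra.
move=> u v; rewrite !lt_min => /andP[u0 /and3P[ud ut us]] /andP[v0 /and3P[vd vt vs]].
have hu : 0 <= u <= geo_len g by lra.
have hv : 0 <= v <= geo_len h by lra.
have du := mdist_geo hu; have dv := mdist_geo hv.
apply: comparison_angle_le; rewrite ?du ?dv// cosc.
have cvx : mdist (g u) (h s) <= s - E * u.
  have := tiny_convex hU Wx Wg Wh (geo_within hg ht0) (t := u); rewrite dt ds => /(_ ltac:(lra)).
  rewrite (_ : (t - u) * s + u * mdist (g t) (h s) = t * (s - E * u)) ?ler_pM2l//.
  have -> : t * (s - E * u) = t * s - u * (E * t) by ring.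
  by rewrite Et; ring.
have := hd (g u) v u E (geo_in_ball hg hu) hE
  ltac:(lra_from hU v0 vd) ltac:(lra_from hU u0 ud) du.
rewrite ds => /(_ cvx); have [le1|le1] := leP (-1) (E - e).
  by lra_from hU le1.
have uv : 0 < u * v by rewrite mulr_gt0.
have tri : mdist (g u) (h v) <= u + v.
  by have := metric_triangle (g u) x (h v); rewrite (metric_sym (g u) x) du dv.
move=> _; have : mdist (g u) (h v) ^+ 2 <= (u + v) ^+ 2.
  by rewrite ler_pXn2r ?nnegrE ?mdist_ge0// addr_ge0 ?ltW.
by lra_from hU uv.
Qed.

(* The cosine of the angle is a supremum of continuous functions. *)
Lemma angle_usc x (g h : geodesic_from x) (e : R) :
  mdist x0 x + geo_len g <= 10 * r0 -> mdist x0 x + geo_len h <= 10 * r0 -> 0 < e ->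
  exists2 d : R, 0 < d & forall y (g' h' : geodesic_from y),
    mdist x0 y + geo_len g' <= 10 * r0 -> mdist x0 y + geo_len h' <= 10 * r0 ->
    mdist x y < d -> mdist (g (geo_len g)) (g' (geo_len g')) < d ->
    mdist (h (geo_len h)) (h' (geo_len h')) < d ->
    angle g' h' < angle g h + e.
Proof.
move=> hg hh e0.
have lg := geo_len_gt0 g; have lh := geo_len_gt0 h.
pose e1 := Num.min e 1.
have e10 : 0 < e1 by rewrite lt_min e0 ltr01.
have e1e : e1 <= e by rewrite ge_min lexx.
have e11 : e1 <= 1 by rewrite ge_min lexx orbT.
have e1pi : 0 <= e1 <= pi by have := @pi_ge2 R; lra.
(* The errors met below add up to at most [3 * n], less than the gap [1 - cos e1]. *)
pose n := (1 - cos e1) / 4.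
have n0 : 0 < n.
  by rewrite divr_gt0// subr_gt0 -cos0 ltr_cos ?in_itv//= ?lexx ?pi_ge0.
have hlh : 0 < geo_len h <= geo_len h by rewrite lh lexx.
have [d1 d10 hd1] := first_variation_ge g hlh n0.
(* [t] is fixed before the perturbation: the difference quotient at [t] is at least the cosine minus
   [n], and it varies continuously with the endpoints. *)
pose t := Num.min (d1 / 2) (geo_len g / 2).
have t0 : 0 < t by rewrite lt_min; apply/andP; split; lra.
have td : t < d1 by apply: (@le_lt_trans _ _ (d1 / 2)); rewrite ?ge_min ?lexx//; lra.
have tg : t <= geo_len g / 2 by rewrite ge_min lexx orbT.
have var := hd1 t ltac:(lra).
have Wx : W x by rewrite /closed_mball /=; lra.
have hlg : 0 <= geo_len g <= geo_len g by rewrite lexx ltW.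
have hlh0 : 0 <= geo_len h <= geo_len h by rewrite lexx ltW.
have dg := mdist_geo hlg; have dh := mdist_geo hlh0.
have tn : 0 < t * n by rewrite mulr_gt0.
have [d2 d20 hd2] := tiny_geodesic_stable hU Wx (geo_in_ball hg hlg) (geo_within hg hlg)
  (s := t) ltac:(rewrite dg; lra) tn.
pose d := Num.min (Num.min (d2 / 4) (geo_len g / 8)) (t * n / 4).
exists d; first by rewrite !lt_min; apply/andP; split; [apply/andP; split|];
  lra_from hU d20 lg tn.
move=> y g' h' hg' hh'; rewrite !lt_min => /andP[/andP[y1 y2] y3].
move=> /andP[/andP[p1 p2] p3] /andP[/andP[q1 q2] q3].
have lg' := geo_len_gt0 g'; have lh' := geo_len_gt0 h'.
have hlg' : 0 <= geo_len g' <= geo_len g' by rewrite lexx ltW.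
have hlh' : 0 <= geo_len h' <= geo_len h' by rewrite lexx ltW.
have dg' := mdist_geo hlg'; have dh' := mdist_geo hlh'.
move: p1 p2 p3 q1 q2 q3 hd2 dg dh dg' dh' var.
set P := g (geo_len g); set P' := g' (geo_len g').
set Q := h (geo_len h); set Q' := h' (geo_len h').
move=> p1 p2 p3 q1 q2 q3 hd2 dg dh dg' dh' var.
have lower : geo_len g <= geo_len g' + mdist x y + mdist P P'.
  by have := metric_triangle x y P; have := metric_triangle y P' P;
     rewrite (metric_sym P' P) dg dg'; lra_from hU.
have upper : geo_len g' <= geo_len g + mdist x y + mdist P P'.
  by have := metric_triangle y x P'; have := metric_triangle x P P';
     rewrite (metric_sym y x) dg dg'; lra_from hU.
have ht' : 0 <= t <= geo_len g' by lra_from hU t0 tg lower y2 p2 lg.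
have dt' := mdist_geo ht'.
have g't : mdist (g' t) P' = geo_len g' - t.
  rewrite /P' geo_dist// distrC ger0_norm ?subr_ge0//.
  by case/andP: ht'.
have close : mdist (g t) (g' t) < t * n.
  apply: hd2; first exact: (geo_in_ball hg').
    by have := metric_triangle x y (g' t); rewrite dt'; lra_from hU y1 d20.
  by have := metric_triangle (g' t) P' P; rewrite (metric_sym P' P) g't dg;
    lra_from hU upper p1 y1 d20.
have fv := first_variation_le (t := t) (s := geo_len h') hg' hh'
  ltac:(lra_from hU t0 ht') ltac:(lra_from hU lh').
have dQ : mdist (g' t) Q' <= mdist (g t) Q + mdist (g t) (g' t) + mdist Q Q'.
  have := metric_triangle (g' t) (g t) Q'; have := metric_triangle (g t) Q Q'.
  by rewrite (metric_sym (g' t) (g t)); lra_from hU.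
have lowerh : geo_len h <= geo_len h' + mdist x y + mdist Q Q'.
  by have := metric_triangle x y Q; have := metric_triangle y Q' Q;
     rewrite (metric_sym Q' Q) dh dh'; lra_from hU.
have fin : t * (cos (angle g h) - 3 * n) <= t * cos (angle g' h').
  by rewrite -/Q' in fv; rewrite -/Q in var; lra_from hU fv var dQ close lowerh y3 q3 tn.
rewrite ler_pM2l// in fin.
apply: (@lt_le_trans _ _ (angle g h + e1)); last by rewrite lerD2l.
apply: ltr_of_cos_gap => //; [by case/andP: (angle_itv g h)|exact: angle_itv|].
by move: n0 fin; rewrite /n; lra_from hU.
Qed.

End tiny_ball_angles.

(** * Extension of geodesics *)

Section metric_compactness.
Context {R : realType} {X : metricType R}.
Implicit Types (x y z p q : X).

Lemma continuous_mdist x : continuous (mdist x : X -> R).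
Proof.
move=> z; apply/cvgrPdist_lt => e e0; apply/nbhs_ballP; exists e => // y.
rewrite ballEmdist/= => zy; apply: le_lt_trans zy.
rewrite (metric_sym x z) (metric_sym x y); exact: mdist_lip.
Qed.

Lemma closed_mball_closed x (r : R) : closed (closed_mball x r).
Proof.
have -> : closed_mball x r = (mdist x : X -> R) @^-1` [set t | t <= r] by [].
by apply: preimage_closed => [z _|]; [exact: continuous_mdist|exact: closed_le].
Qed.

(** A tube lemma over [K] times [K]. Angles are controlled through endpoints of geodesics, so this
    makes semicontinuity uniform over geodesics. *)
Lemma compact_uniform2 (K : set X) x (P : X -> X -> X -> Prop) : compact K ->
  (forall z w, K z -> K w -> exists2 d : R, 0 < d & forall z' w' y,
     mdist z z' < d -> mdist w w' < d -> mdist x y < d -> P y z' w') ->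
  exists2 d : R, 0 < d & forall y, mdist x y < d -> forall z w, K z -> K w -> P y z w.
Proof.
move=> cK hP; have cKK := compact_setX cK cK.
have cov := (compact_near_coveringP _).1 cKK X (nbhs x) (fun y zw => P y zw.1 zw.2)
  (nbhs_filter x).
have /cov/nbhs_ballP[d /= d0 hd] : forall zw, (K `*` K) zw ->
    \forall zw' \near zw & y \near nbhs x, P y zw'.1 zw'.2.
  move=> [z w] [/= Kz Kw]; have [d d0 hd] := hP z w Kz Kw.
  exists (ball (z, w) d, ball x d); first by split; exact: nbhsx_ballx.
  move=> [[z' w'] y] /= [[]]; rewrite !ballEmdist /= => ? ? ?; exact: hd.
exists d => // y xy z w Kz Kw.
by apply: (hd y _ (z, w)) => //; rewrite ballEmdist.
Qed.

Lemma compact_uniform (K : set X) x (P : X -> X -> Prop) : compact K ->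
  (forall z, K z -> exists2 d : R, 0 < d & forall z' y,
     mdist z z' < d -> mdist x y < d -> P y z') ->
  exists2 d : R, 0 < d & forall y, mdist x y < d -> forall z, K z -> P y z.
Proof.
move=> cK hP; have [|d d0 hd] := @compact_uniform2 K x (fun y z _ => P y z) cK.
  by move=> z w Kz Kw; have [d d0 hd] := hP z Kz; exists d => // z' w' y zz _; exact: hd.
by exists d => // y xy z Kz; apply: (hd y xy z z).
Qed.

Lemma compact_cluster (K : set X) (u : nat -> X) : compact K -> (forall n, K (u n)) ->
  exists2 z, K z & forall (e : R) N, 0 < e -> exists2 n, (N <= n)%N & mdist z (u n) < e.
Proof.
move=> cK Ku; have [|z [Kz cz]] := cK (u @ \oo) _; first by exists 0%N => // n _; exact: Ku.
exists z => // e N e0.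
have [|_ [[n Nn <-] zn]] := cz (u @` [set n | (N <= n)%N]) (ball z e) _ (nbhsx_ballx z e e0).
  by exists N => // n /= Nn; exists n.
by exists n => //; move: zn; rewrite ballEmdist.
Qed.

Lemma ord_lower_bound k (f : 'I_k -> R) : (forall i, 0 < f i) ->
  exists2 d : R, 0 < d & forall i, d <= f i.
Proof.
elim: k f => [|k IH] f f0; first by exists 1 => // -[].
have [d d0 hd] := IH (fun i => f (lift ord0 i)) (fun i => f0 _).
exists (Num.min d (f ord0)); first by rewrite lt_min d0 f0.
by move=> i; case: (unliftP ord0 i) => [j|] ->; rewrite ge_min ?hd ?lexx ?orbT.
Qed.

End metric_compactness.

(** * Extension of geodesics to a definite length *)

Section tiny_ball_extension.
Context {R : realType} {X : metricType R} (kappa : R) (x0 : X) (r0 : R).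
Hypothesis hU : tiny_ball kappa x0 r0.
Hypothesis hX : locally_geodesically_complete X.
Implicit Types (x y z p q r : X) (s t : R).

Local Notation W := (closed_mball x0 (10 * r0)).

Lemma closed_mballP x (r : R) y : closed_mball x r y = (mdist x y <= r) :> Prop.
Proof. by []. Qed.

Lemma geodesic_to x p : mdist x0 x + mdist x p <= 10 * r0 -> p <> x ->
  exists g : geodesic_from x, geo_len g = mdist x p /\ g (geo_len g) = p.
Proof.
move=> h px; have hx : W x by rewrite closed_mballP; have := mdist_ge0 x p; lra.
have hp : W p by rewrite closed_mballP; have := metric_triangle x0 x p; lra.
have [g [[gg g0 g1] _]] := tiny_geodesic hU hx hp.
have l0 : 0 < mdist x p by rewrite mdist_gt0; apply/eqP => e; apply: px.
by exists (GeodesicFrom l0 gg g0).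
Qed.

Lemma geodesic_unique x (g h : geodesic_from x) t :
  mdist x0 x + geo_len h <= 10 * r0 -> 0 <= t <= geo_len g -> geo_len g <= geo_len h ->
  mdist (g (geo_len g)) (h (geo_len h)) = geo_len h - geo_len g -> h t = g t.
Proof.
move=> hh ht gh e; have lg := geo_len_gt0 g; have lh := geo_len_gt0 h.
have hlh : 0 <= geo_len h <= geo_len h by lra.
have Wx : W x by rewrite closed_mballP; lra.
have dh := mdist_geo hlh; have dg := mdist_geo ht.
have Wg : W (g t) by rewrite closed_mballP; have := metric_triangle x0 x (g t); lra.
apply: (tiny_geodesic_unique hU Wx (geo_in_ball hh hlh) Wg (geo_within hh hlh)) => //.
  by rewrite dh; lra.
apply/eqP; rewrite eq_le; apply/andP; split.
  have := metric_triangle (g t) (g (geo_len g)) (h (geo_len h)).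
  by rewrite e dh geo_dist; [rewrite distrC ger0_norm ?subr_ge0; lra|lra|lra].
by have := metric_triangle x (g t) (h (geo_len h)); lra.
Qed.

Lemma angle_eq0 x (g h : geodesic_from x) :
  mdist x0 x + geo_len h <= 10 * r0 -> geo_len g <= geo_len h ->
  mdist (g (geo_len g)) (h (geo_len h)) = geo_len h - geo_len g -> angle g h = 0.
Proof.
move=> hh gh e; apply: (@angle_germ _ _ _ _ _ (geo_len g)); first exact: geo_len_gt0.
by move=> t ht; rewrite (geodesic_unique hh ht gh e).
Qed.

(** Geodesic completeness yields only a local geodesic beyond [z]. It is a geodesic on
    [[l - t, l + t]] for [l] the distance from [x] to [z], and convexity of the distance to [x] at
    the midpoint [z] forces the new end to distance at least [l + t]. *)
Lemma local_extension x z : x <> z -> mdist x0 x + mdist x z < 10 * r0 ->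
  exists2 e : R, 0 < e & forall t, 0 < t < e ->
    exists2 z', mdist x z' = mdist x z + t & mdist z z' = t.
Proof.
move=> xz hz; have l0 : 0 < mdist x z by rewrite mdist_gt0; apply/eqP.
have hx : W x by rewrite closed_mballP; lra.
have Wz : W z by rewrite closed_mballP; have := metric_triangle x0 x z; lra.
have [g [[gg g0 g1] gW]] := tiny_geodesic hU hx Wz.
have lg : local_geodesic_on `[0, mdist x z]%classic g.
  by move=> t ht; exists 1 => // u v [hu _] [hv _]; exact: gg.
have [e e0 [g' [lg' gg']]] := hX l0 lg.
have [|e' e'0 ge'] := lg' (mdist x z); first by rewrite /= in_itv/=; lra.
exists (Num.min (Num.min e e') (Num.min (mdist x z) (10 * r0 - mdist x0 x - mdist x z))).
  by rewrite !lt_min e0 e'0 l0; lra.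
move=> t; rewrite !lt_min => /andP[t0 /andP[/andP[te te'] /andP[tl tr]]].
have geo u v : mdist x z - t <= u <= mdist x z + t -> mdist x z - t <= v <= mdist x z + t -> mdist (g' u) (g' v) = `|u - v|.
  by move=> hu hv; apply: ge'; split; rewrite /= in_itv/=; lra.
have g'l : g' (mdist x z) = z by rewrite gg' ?g1// /= in_itv/= lexx ltW.
have g't : g' (mdist x z - t) = g (mdist x z - t) by rewrite gg'// /= in_itv/=; lra.
have zz' : mdist z (g' (mdist x z + t)) = t.
  by rewrite -{1}g'l geo; [rewrite distrC ger0_norm; lra|lra|lra].
have xg : mdist x (g (mdist x z - t)) = mdist x z - t.
  have := gg 0 (mdist x z - t); rewrite g0 sub0r normrN ger0_norm; last lra.
  by apply; rewrite /= in_itv/=; lra.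
have duv : mdist (g' (mdist x z - t)) (g' (mdist x z + t)) = 2 * t.
  by rewrite geo; [rewrite distrC ger0_norm; lra|lra|lra].
have x0z := metric_triangle x0 x z.
have inW u : mdist x z - t <= u <= mdist x z + t -> W (g' u).
  move=> hu; rewrite closed_mballP; have := metric_triangle x0 z (g' u).
  have : mdist z (g' u) <= t.
    by rewrite -{1}g'l geo ?ler_norml; lra.
  by lra.
have hgw : geodesic_within W (g' (mdist x z - t)) (g' (mdist x z + t)) (fun u => g' (mdist x z - t + u)).
  rewrite /geodesic_within /geodesic_between duv; split.
    split; [|by rewrite addr0|by congr g'; ring].
    move=> u v; rewrite /= !in_itv/= => hu hv; rewrite geo; [|lra|lra].
    by congr `|_|; ring.
  by move=> u; rewrite /= in_itv/= => hu; apply: inW; lra.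
exists (g' (mdist x z + t)) => //; apply/eqP; rewrite eq_le; apply/andP; split.
  by have := metric_triangle x z (g' (mdist x z + t)); rewrite zz'.
have := tiny_midpoint hU (inW (mdist x z - t) ltac:(lra)) (inW (mdist x z + t) ltac:(lra)) hx hgw.
rewrite duv (_ : mdist x z - t + 2 * t / 2 = mdist x z); last by field.
rewrite g'l g't (metric_sym z) (metric_sym (g _)) xg (metric_sym (g' _)); lra.
Qed.

(** By compactness some [z] is farthest from [x] among the points of the ball of radius [L] for
    which [p] lies between [x] and [z]; if it were closer than [L], [local_extension] would push it
    further. *)
Lemma extension_point x p (L : R) : x <> p -> mdist x p <= L -> mdist x0 x + L < 10 * r0 ->
  exists2 z, mdist x z = L & mdist p z = L - mdist x p.
Proof.
move=> xp pL hL.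
pose K := closed_mball x L `&` [set z | mdist x z - mdist p z = mdist x p].
have cW : compact W by case: hU.
have KW : closed_mball x L `<=` W.
  by move=> z; rewrite !closed_mballP => h; have := metric_triangle x0 x z; lra.
have cK : compact K.
  apply: compact_closedI.
    exact: (subclosed_compact (@closed_mball_closed _ _ x L) cW KW).
  have -> : [set z | mdist x z - mdist p z = mdist x p] =
     (fun z => mdist x z - mdist p z) @^-1` [set mdist x p] by [].
  apply: preimage_closed => [z _|]; last exact: closed_eq.
  by apply: cvgB; exact: continuous_mdist.
have [|z] := compact_EVT_max (_ : K !=set0) cK (continuous_subspaceT (@continuous_mdist _ _ x)).
  by exists p; split => //=; rewrite mdistxx subr0.
rewrite inE => -[/= zL e1] zmax; rewrite closed_mballP in zL.
have dpz : mdist p z = mdist x z - mdist x p by lra.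
have [zL'|zL'] := ltP (mdist x z) L; last first.
  have xz : mdist x z = L by apply/eqP; rewrite eq_le zL zL'.
  by exists z => //; rewrite dpz xz.
have xz : x <> z.
  move=> e; move: e1; rewrite -e mdistxx (metric_sym p) => e1; apply: xp.
  by apply: mdist_positivity; have := mdist_ge0 x p; lra.
have [|e e0 he] := local_extension xz; first lra.
pose t := Num.min (e / 2) (L - mdist x z).
have t0 : 0 < t by rewrite lt_min; lra.
have tL : t <= L - mdist x z by rewrite ge_min lexx orbT.
have te : t < e by apply: (@le_lt_trans _ _ (e / 2)); rewrite ?ge_min ?lexx//; lra.
have [z' xz' zz'] := he t ltac:(lra).
have : mdist x z' <= mdist x z.
  apply: zmax; rewrite inE; split; first by rewrite closed_mballP; lra.
  rewrite /=; have := metric_triangle x p z'; have := metric_triangle p z z'; lra.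
lra.
Qed.

(** Only the germ of [g] matters: [g] may be longer than [L] or leave the ball, so it is first cut
    to length [l]. *)
Lemma geodesic_extension x (g : geodesic_from x) (L : R) : 0 < L -> mdist x0 x + L < 10 * r0 ->
  exists2 h : geodesic_from x, geo_len h = L & angle g h = 0.
Proof.
move=> L0 hL; have lg := geo_len_gt0 g.
pose l := Num.min (geo_len g) L.
have l0 : 0 < l by rewrite lt_min lg L0.
have lL : l <= L by rewrite ge_min lexx orbT.
have llg : l <= geo_len g by rewrite ge_min lexx.
have gl : geodesic_on `[0, l]%classic g.
  by move=> s t; rewrite /= !in_itv/= => hs ht; apply: geo_dist; lra.
pose g' := GeodesicFrom l0 gl (geo_start g).
have dl : mdist x (g l) = l by apply: mdist_geo; lra.
have xgl : x <> g l by move=> e; have := l0; rewrite -dl -e mdistxx ltxx.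
have gL : mdist x (g l) <= L by rewrite dl.
have [z xz gz] := extension_point xgl gL hL.
have zx : z <> x by move=> e; have := L0; rewrite -xz e mdistxx ltxx.
have [h [lh hz]] : exists g : geodesic_from x, geo_len g = mdist x z /\ g (geo_len g) = z.
  by apply: geodesic_to => //; lra.
exists h; first by rewrite lh.
have g'h : angle g' h = 0.
  by apply: angle_eq0; rewrite /= ?hz ?lh ?xz ?gz ?dl//; lra.
have gg' : angle g g' = 0 by apply: (@angle_germ _ _ _ _ _ l).
apply/eqP; rewrite eq_le; case/andP: (angle_itv g h) => -> _; rewrite andbT.
by have := angle_triangle g g' h; rewrite g'h gg' addr0.
Qed.

(* This makes the space of directions compact, as an image of the sphere of radius [r0]. *)
Lemma direction_of_geodesic x (w : directions x) : mdist x0 x <= 2 * r0 ->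
  exists2 h : geodesic_from x, geo_len h = r0 & dir_dist w (dir_of h) = 0.
Proof.
move=> hx; have r00 := tiny_radius_gt0 hU.
have [g hg] : exists g : nat -> geodesic_from x, forall n,
    geo_len (g n) = r0 /\ angle (w n) (g n) = 0.
  suff /choice[g hg] : forall n, exists g : geodesic_from x,
    geo_len g = r0 /\ angle (w n) g = 0 by exists g.
  by move=> n; have [|h ? ?] := geodesic_extension (w n) r00; [lra|exists h].
have hball n : mdist x0 x + geo_len (g n) <= 10 * r0 by rewrite (hg n).1; lra.
have hr n : 0 <= r0 <= geo_len (g n) by rewrite (hg n).1; lra.
have cW : compact W by case: hU.
(* The geodesic to a cluster point of the endpoints represents the limit of the Cauchy sequence
   [w]. *)
have [z Wz cz] := compact_cluster cW (fun n => geo_in_ball (hball n) (hr n)).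
have dz : mdist x z = r0.
  suff : forall e : R, 0 < e -> `|mdist x z - r0| <= e.
    move=> h; apply/eqP; rewrite -subr_eq0 -normr_le0; apply/ler_addgt0Pr => e e0.
    by rewrite add0r; exact: h.
  move=> e e0; have [n _ zn] := cz e 0%N e0.
  rewrite -{1}(mdist_geo (hr n)) (metric_sym x z) (metric_sym x (g n r0)).
  by apply: le_trans (mdist_lip _ _ _) (ltW zn).
have zx : z <> x by move=> e; have := r00; rewrite -dz e mdistxx ltxx.
have [h [lh hz]] : exists g : geodesic_from x, geo_len g = mdist x z /\ g (geo_len g) = z.
  by apply: geodesic_to => //; lra.
exists h; first by rewrite lh.
apply/eqP; rewrite eq_le; case/andP: (dir_dist_itv w (dir_of h)) => -> _; rewrite andbT.
apply/ler_addgt0Pr => e e0; rewrite add0r.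
pose e1 := Num.min (e / 2) 1.
have e10 : 0 < e1 by rewrite lt_min; lra.
have e1e : e1 <= e / 2 by rewrite ge_min lexx.
have e11 : e1 <= 1 by rewrite ge_min lexx orbT.
have e1pi : 0 <= e1 <= pi by have := @pi_ge2 R; lra.
have c1 : cos e1 < 1 by rewrite -cos0 ltr_cos ?in_itv//= ?lexx ?pi_ge0.
have [N hN] := @dir_cauchy _ _ _ w (e / 2) ltac:(lra).
(* First variation over length [r0] turns an endpoint error below [r0 * (1 - cos e1)] into an angle
   below [e1]. *)
have [n Nn zn] := cz (r0 * (1 - cos e1)) N ltac:(by rewrite mulr_gt0// subr_gt0).
have hn : angle (g n) h < e1.
  rewrite -[e1]add0r; apply: ltr_of_cos_gap; rewrite ?lexx ?angle_itv// cos0.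
  have := first_variation_le hU (hball n) (h := h) (t := r0) (s := r0).
  rewrite lh dz => /(_ ltac:(lra) ltac:(by rewrite (hg n).1; lra) ltac:(lra)).
  have -> : h r0 = z by rewrite -hz lh dz.
  rewrite (metric_sym _ z) => fv.
  by rewrite -(ltr_pM2l r00); lra.
apply: (@dir_dist_le _ _ _ _ _ _ N) => m Nm /=.
have := hN m n Nm Nn; have := angle_triangle (w m) (w n) h.
by have := angle_triangle (w n) (g n) h; rewrite (hg n).2; lra.
Qed.

End tiny_ball_extension.

(** * Strained points *)

Section strained_points.
Context {R : realType} {X : metricType R} (kappa : R) (x0 : X) (r0 : R).
Hypothesis hU : tiny_ball kappa x0 r0.
Hypothesis hX : locally_geodesically_complete X.
Implicit Types (x y z p q r : X) (s t : R).

Local Notation W := (closed_mball x0 (10 * r0)).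

(** For [w] with endpoint near a given [z] this is semicontinuity of both angles; compactness of the
    ball makes it uniform in [w]. *)
Lemma spherical_points_open x (g h : geodesic_from x) (c : R) :
  mdist x0 x <= r0 -> geo_len g = r0 -> geo_len h = r0 ->
  (forall w : geodesic_from x, geo_len w = r0 -> angle g w + angle w h < c) ->
  exists2 d : R, 0 < d & forall y (g' h' : geodesic_from y), mdist x y < d ->
    g' (geo_len g') = g r0 -> h' (geo_len h') = h r0 ->
    forall w : geodesic_from y, geo_len w = r0 -> angle g' w + angle w h' < c.
Proof.
move=> hx lg lh hc; have r00 := tiny_radius_gt0 hU.
pose P y z := mdist x y < r0 -> forall g' h' w : geodesic_from y,
  g' (geo_len g') = g r0 -> h' (geo_len h') = h r0 -> geo_len w = r0 -> w r0 = z ->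
  angle g' w + angle w h' < c.
have cW : compact W by case: hU.
have len y (g' : geodesic_from y) : mdist y (g' (geo_len g')) = geo_len g'.
  by apply: mdist_geo; rewrite lexx ltW// geo_len_gt0.
have [|d d0 hd] := @compact_uniform _ _ W x P cW.
  move=> z Wz; have [zr|zr] := eqVneq (mdist x z) r0; last first.
    have e0 : 0 < `|mdist x z - r0| by rewrite normr_gt0 subr_eq0.
    exists (`|mdist x z - r0| / 2); first by lra.
    move=> z' y zz' xy _ g' h' w _ _ lw wz; exfalso.
    have yz' : mdist y z' = r0 by rewrite -wz -{1}lw len.
    have := mdist_lip x y z; have := mdist_lip z z' y.
    rewrite (metric_sym z y) (metric_sym z' y) yz' => h1 h2.
    have := ler_normD (mdist x z - mdist y z) (mdist y z - r0).
    by rewrite addrA subrK; lra.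
  have zx : z <> x by move=> e; have := r00; rewrite -zr e mdistxx ltxx.
  have [w0 [lw0 w0z]] : exists w : geodesic_from x, geo_len w = mdist x z /\ w (geo_len w) = z.
    by apply: (geodesic_to hU) => //; lra.
  have sum := hc w0 ltac:(by rewrite lw0).
  have e0 : 0 < (c - (angle g w0 + angle w0 h)) / 2 by lra.
  have bg : mdist x0 x + geo_len g <= 10 * r0 by lra.
  have bh : mdist x0 x + geo_len h <= 10 * r0 by lra.
  have bw : mdist x0 x + geo_len w0 <= 10 * r0 by lra.
  have [d1 d10 hd1] := angle_usc hU bg bw e0.
  have [d2 d20 hd2] := angle_usc hU bw bh e0.
  exists (Num.min (Num.min d1 d2) r0); first by rewrite !lt_min d10 d20.
  move=> z' y; rewrite !lt_min => /andP[/andP[z1 z2] z3] /andP[/andP[y1 y2] y3] _ g' h' w eg eh lw wz.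
  have tri := metric_triangle x0 x y.
  have lg' : geo_len g' <= r0 + mdist x y.
    have := metric_triangle y x (g r0); rewrite -{1}eg len (metric_sym y x) mdist_geo ?lg//.
      by lra.
    by lra.
  have lh' : geo_len h' <= r0 + mdist x y.
    have := metric_triangle y x (h r0); rewrite -{1}eh len (metric_sym y x) mdist_geo ?lh//.
      by lra.
    by lra.
  have a1 : angle g' w < angle g w0 + (c - (angle g w0 + angle w0 h)) / 2.
    by apply: hd1 => //; rewrite ?w0z ?lw ?wz ?eg ?lg ?mdistxx//;
      lra_from hU hX tri hx lg' y3 d10 r00.
  have a2 : angle w h' < angle w0 h + (c - (angle g w0 + angle w0 h)) / 2.
    by apply: hd2 => //; rewrite ?w0z ?lw ?wz ?eh ?lh ?mdistxx//;
      lra_from hU hX tri hx lh' y3 d20 r00.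
  by lra_from hU hX a1 a2.
exists (Num.min d r0); first by rewrite lt_min d0.
move=> y g' h'; rewrite lt_min => /andP[y1 y2] eg eh w lw.
apply: (hd y y1 (w r0)) => //.
by apply: (geo_in_ball (g := w)); have := metric_triangle x0 x y; lra.
Qed.

(** In [strainer_extension] the endpoints depend on [y], so [d] must be chosen before them. The
    lower bound [rho] keeps the endpoints away from [x], where no direction is defined. *)
Lemma angle_usc_uniform x (rho e : R) : mdist x0 x <= r0 -> 0 < rho -> 0 < e ->
  exists2 d : R, 0 < d & forall y, mdist x y < d ->
    forall (g' h' : geodesic_from y) (g h : geodesic_from x),
    rho <= geo_len g' -> rho <= geo_len h' -> geo_len g <= 8 * r0 -> geo_len h <= 8 * r0 ->
    g' (geo_len g') = g (geo_len g) -> h' (geo_len h') = h (geo_len h) ->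
    angle g' h' < angle g h + e.
Proof.
move=> hx rho0 e0; have r00 := tiny_radius_gt0 hU.
pose K := closed_mball x (8 * r0).
have cK : compact K.
  have cW : compact W by case: hU.
  apply: (subclosed_compact (@closed_mball_closed _ _ x _) cW) => z.
  by rewrite /closed_mball /=; have := metric_triangle x0 x z; lra.
have len y (g' : geodesic_from y) : mdist y (g' (geo_len g')) = geo_len g'.
  by apply: mdist_geo; rewrite lexx ltW// geo_len_gt0.
pose P y z w := mdist x y < r0 / 2 -> forall (g' h' : geodesic_from y) (g h : geodesic_from x),
    rho <= geo_len g' -> rho <= geo_len h' -> geo_len g <= 8 * r0 -> geo_len h <= 8 * r0 ->
    g (geo_len g) = z -> h (geo_len h) = w ->
    g' (geo_len g') = g (geo_len g) -> h' (geo_len h') = h (geo_len h) ->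
    angle g' h' < angle g h + e.
have far z : mdist x z < rho -> exists2 d : R, 0 < d & forall z' y,
    mdist z z' < d -> mdist x y < d -> mdist y z' < rho.
  move=> zr; exists ((rho - mdist x z) / 2); first by lra.
  move=> z' y zz' xy; have := metric_triangle y x z'; have := metric_triangle x z z'.
  by rewrite (metric_sym y x); lra.
have to z : K z -> rho <= mdist x z ->
    exists2 w : geodesic_from x, geo_len w <= 8 * r0 & w (geo_len w) = z.
  move=> Kz zr; have [||w [lw wz]] := @geodesic_to _ _ _ _ _ hU x z.
  - by move: Kz; rewrite /K /closed_mball /=; lra.
  - by move=> ez; move: zr; rewrite ez mdistxx leNgt rho0.
  - by exists w => //; rewrite lw.
have [|d d0 hd] := @compact_uniform2 _ _ K x P cK.
  move=> z w Kz Kw; have [zr|zr] := leP rho (mdist x z); last first.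
    have [d d0 hd] := far z zr; exists d => // z' w' y zz' _ xy _ g' h' g h l1 _ _ _ gz _ eg _.
    by have := hd z' y zz' xy; rewrite -gz -eg len ltNge l1.
  have [wr|wr] := leP rho (mdist x w); last first.
    have [d d0 hd] := far w wr; exists d => // z' w' y _ ww' xy _ g' h' g h _ l1 _ _ _ hw _ eh.
    by have := hd w' y ww' xy; rewrite -hw -eh len ltNge l1.
  have [z0 lz0 z0z] := to z Kz zr; have [w0 lw0 w0w] := to w Kw wr.
  have bz : mdist x0 x + geo_len z0 <= 10 * r0 by lra.
  have bw : mdist x0 x + geo_len w0 <= 10 * r0 by lra.
  have e4 : 0 < e / 4 by lra.
  have [d1 d10 hd1] := angle_usc hU bz bw e4.
  have [d2 d20 hd2] := angle_usc hU bz bz e4.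
  have [d3 d30 hd3] := angle_usc hU bw bw e4.
  exists (Num.min d1 (Num.min d2 d3)); first by rewrite !lt_min d10 d20.
  move=> z' w' y; rewrite !lt_min => /and3P[z1 z2 z3] /and3P[w1 w2 w3] /and3P[y1 y2 y3].
  move=> y4 g' h' g h l1 l2 l3 l4 gz hw eg eh.
  have tri := metric_triangle x0 x y.
  have lg' : geo_len g' <= geo_len g + mdist x y.
    have := metric_triangle y x (g (geo_len g)).
    by rewrite -{1}eg !len (metric_sym y x); lra_from hU hX.
  have lh' : geo_len h' <= geo_len h + mdist x y.
    have := metric_triangle y x (h (geo_len h)).
    by rewrite -{1}eh !len (metric_sym y x); lra_from hU hX.
  have a1 : angle g' h' < angle z0 w0 + e / 4.
    by apply: hd1; rewrite ?z0z ?w0w ?eg ?eh ?gz ?hw//;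
      lra_from hU hX hx r00 tri lg' lh' l3 l4 y4.
  (* Semicontinuity at the pair [(z0, z0)], of angle 0, shows that geodesics from [x] with nearby
     endpoints have nearby directions. This allows [z0] and [w0] to be replaced by [g] and [h]. *)
  have a2 : angle z0 g < angle z0 z0 + e / 4.
    by apply: hd2; rewrite ?z0z ?gz ?mdistxx//; lra_from hU hX hx r00 l3.
  have a3 : angle w0 h < angle w0 w0 + e / 4.
    by apply: hd3; rewrite ?w0w ?hw ?mdistxx//; lra_from hU hX hx r00 l4.
  rewrite !angle_refl in a2 a3.
  by have := angle_dist z0 g w0 h; rewrite ler_norml => /andP[_]; lra_from hU hX a1 a2 a3 e0.
exists (Num.min d (r0 / 2)); first by rewrite lt_min d0; lra.
move=> y; rewrite lt_min => /andP[y1 y2] g' h' g h l1 l2 l3 l4 eg eh.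
by apply: (hd y y1 (g (geo_len g)) (h (geo_len h))) => //; rewrite /K /closed_mball /= len.
Qed.

Lemma strained_of_geodesics y (k : nat) (delta : R) (g h : 'I_k -> geodesic_from y) :
  mdist x0 y <= 2 * r0 ->
  (forall i (w : geodesic_from y), geo_len w = r0 -> angle (g i) w + angle w (h i) < pi + delta) ->
  (forall i j, i != j -> [/\ angle (g i) (h j) < pi / 2 + delta,
     angle (g i) (g j) < pi / 2 + delta & angle (h i) (h j) < pi / 2 + delta]) ->
  strained k delta y.
Proof.
move=> hy h1 h2; exists (fun i => dir_of (g i)), (fun i => dir_of (h i)); split.
  move=> i w; have [w' lw ww'] := direction_of_geodesic hU hX w hy.
  rewrite (dir_distC w) !(dir_dist_eq0 _ ww') (dir_distC (dir_of (h i))) !dir_dist_dir_of.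
  exact: h1.
by move=> i j ij; rewrite !dir_dist_dir_of; exact: h2.
Qed.

Lemma strained_geodesics x (k : nat) (delta : R) : mdist x0 x <= 2 * r0 -> strained k delta x ->
  exists g h : 'I_k -> geodesic_from x,
  [/\ forall i, geo_len (g i) = r0, forall i, geo_len (h i) = r0,
   forall i (w : geodesic_from x), angle (g i) w + angle w (h i) < pi + delta
  & forall i j, i != j -> [/\ angle (g i) (h j) < pi / 2 + delta,
     angle (g i) (g j) < pi / 2 + delta & angle (h i) (h j) < pi / 2 + delta]].
Proof.
move=> hx [v [vb [h1 h2]]].
have rep (u : 'I_k -> directions x) : exists g : 'I_k -> geodesic_from x, forall i,
    geo_len (g i) = r0 /\ dir_dist (u i) (dir_of (g i)) = 0.
  suff /choice[g hg] : forall i, exists g : geodesic_from x,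
    geo_len g = r0 /\ dir_dist (u i) (dir_of g) = 0 by exists g.
  by move=> i; have [g ? ?] := direction_of_geodesic hU hX (u i) hx; exists g.
have [g hg] := rep v; have [h hh] := rep vb.
have repl (u u' : directions x) (a b : geodesic_from x) : dir_dist u (dir_of a) = 0 ->
    dir_dist u' (dir_of b) = 0 -> dir_dist u u' = angle a b.
  move=> ua ub; rewrite (dir_dist_eq0 _ ub) dir_distC (dir_dist_eq0 _ ua).
  by rewrite dir_distC dir_dist_dir_of.
exists g, h; split => [i|i|i w|i j ij]; [exact: (hg i).1|exact: (hh i).1| |].
  have ww : dir_dist (dir_of w) (dir_of w) = 0 by rewrite dir_dist_dir_of angle_refl.
  by rewrite -(repl _ _ _ _ (hg i).2 ww) -(repl _ _ _ _ ww (hh i).2); exact: h1.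
rewrite -(repl _ _ _ _ (hg i).2 (hh j).2) -(repl _ _ _ _ (hg i).2 (hg j).2).
by rewrite -(repl _ _ _ _ (hh i).2 (hh j).2); exact: h2.
Qed.

(** The conditions are strict upper bounds on angles, hence stable under semicontinuity; the tuples
    at [y] are the geodesics to the endpoints of those at [x]. *)
Lemma strained_open x (k : nat) (delta : R) : mdist x0 x < r0 -> strained k delta x ->
  exists2 d : R, 0 < d & forall y, mdist x y < d -> strained k delta y.
Proof.
move=> hx sx; have r00 := tiny_radius_gt0 hU.
have [|g [h [lg lh h1 h2]]] := strained_geodesics _ sx; first by lra.
have hx1 := ltW hx.
have open1 i := spherical_points_open hx1 (lg i) (lh i) (fun w _ => h1 i w).
have /choice[d1 hd1] : forall i : 'I_k, exists d : R, 0 < d /\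
    forall y (g' h' : geodesic_from y), mdist x y < d ->
    g' (geo_len g') = g i r0 -> h' (geo_len h') = h i r0 ->
    forall w : geodesic_from y, geo_len w = r0 -> angle g' w + angle w h' < pi + delta.
  by move=> i; have [d ? ?] := open1 i; exists d.
have open2 (a b : geodesic_from x) (c : R) : geo_len a = r0 -> geo_len b = r0 -> angle a b < c ->
    exists2 d : R, 0 < d & forall y (a' b' : geodesic_from y),
      geo_len a' <= 2 * r0 -> geo_len b' <= 2 * r0 -> mdist x y < d ->
      a' (geo_len a') = a r0 -> b' (geo_len b') = b r0 -> angle a' b' < c.
  move=> la lb abc; have e0 : 0 < c - angle a b by lra.
  have ba : mdist x0 x + geo_len a <= 10 * r0 by lra.
  have bb : mdist x0 x + geo_len b <= 10 * r0 by lra.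
  have [d d0 hd] := angle_usc hU ba bb e0.
  exists (Num.min d r0); first by rewrite lt_min d0.
  move=> y a' b' la' lb'; rewrite lt_min => /andP[y1 y2] ea eb.
  have tri := metric_triangle x0 x y.
  have := hd y a' b'; rewrite ea eb la lb !mdistxx => hab.
  by have := hab ltac:(lra) ltac:(lra) y1 d0 d0; lra_from hU hX.
have /choice[d2 hd2] : forall ij : 'I_k * 'I_k, exists d : R, 0 < d /\ (ij.1 != ij.2 ->
    forall y (a b a' b' : geodesic_from y),
      geo_len a <= 2 * r0 -> geo_len b <= 2 * r0 ->
      geo_len a' <= 2 * r0 -> geo_len b' <= 2 * r0 -> mdist x y < d ->
      a (geo_len a) = g ij.1 r0 -> b (geo_len b) = g ij.2 r0 ->
      a' (geo_len a') = h ij.1 r0 -> b' (geo_len b') = h ij.2 r0 ->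
      [/\ angle a b' < pi / 2 + delta, angle a b < pi / 2 + delta
        & angle a' b' < pi / 2 + delta]).
  move=> [i j] /=; have [->|ij] := eqVneq i j; first by exists 1.
  have [q1 q2 q3] := h2 i j ij.
  have [d3 d30 hd3] := open2 _ _ _ (lg i) (lh j) q1.
  have [d4 d40 hd4] := open2 _ _ _ (lg i) (lg j) q2.
  have [d5 d50 hd5] := open2 _ _ _ (lh i) (lh j) q3.
  exists (Num.min d3 (Num.min d4 d5)); split; first by rewrite !lt_min d30 d40.
  move=> _ y a b a' b' la lb la' lb'; rewrite !lt_min => /and3P[y3 y4 y5] ea eb ea' eb'.
  by split; [exact: hd3|exact: hd4|exact: hd5].
have [e1 e10 he1] := ord_lower_bound (fun i => (hd1 i).1).
have [e2 e20 he2] : exists2 d : R, 0 < d & forall ij, d <= d2 ij.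
  have [f f0 hf] := @ord_lower_bound _ #|{: 'I_k * 'I_k}| (fun i => d2 (enum_val i))
    (fun i => (hd2 _).1).
  by exists f => // ij; rewrite -(enum_rankK ij).
exists (Num.min (Num.min e1 e2) (r0 / 2)); first by rewrite !lt_min e10 e20 divr_gt0.
move=> y; rewrite !lt_min => /andP[/andP[y1 y2] y3].
have tri := metric_triangle x0 x y.
have to (a : geodesic_from x) : geo_len a = r0 -> exists b : geodesic_from y,
    geo_len b <= 2 * r0 /\ b (geo_len b) = a r0.
  move=> la; have xa : mdist x (a r0) = r0 by rewrite mdist_geo// la lexx ltW.
  have tri1 := metric_triangle y x (a r0); have tri2 := metric_triangle x y (a r0).
  rewrite (metric_sym y x) in tri1.
  have [||b [lb bz]] := @geodesic_to _ _ _ _ _ hU y (a r0); first by lra.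
    by move=> e; move: xa; rewrite e; lra.
  by exists b; split => //; lra.
have /choice[g' hg'] : forall i, exists b : geodesic_from y,
  geo_len b <= 2 * r0 /\ b (geo_len b) = g i r0 by move=> i; exact: to.
have /choice[h' hh'] : forall i, exists b : geodesic_from y,
  geo_len b <= 2 * r0 /\ b (geo_len b) = h i r0 by move=> i; exact: to.
apply: (@strained_of_geodesics y k delta g' h'); first by lra.
  move=> i w lw; apply: (hd1 i).2 => //; [|exact: (hg' i).2|exact: (hh' i).2].
  exact: lt_le_trans (he1 i).
move=> i j ij; apply: ((hd2 (i, j)).2 ij) => /=; rewrite ?(hg' _).2 ?(hh' _).2 ?(hg' _).1 ?(hh' _).1//.
exact: lt_le_trans (he2 _).
Qed.

End strained_points.

(** * Strainer maps *)

Lemma leD_pi_of_cos {R : realType} (a b : R) : 0 <= a <= pi -> 0 <= b <= pi ->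
  0 <= cos a + cos b -> a + b <= pi.
Proof.
move=> ha hb h; suff : a <= pi - b by lra.
rewrite -ler_cos ?in_itv//=; last by lra.
by rewrite cosB cospi sinpi; lra.
Qed.

Section strainer_maps.
Context {R : realType} {X : metricType R} (kappa : R) (x0 : X) (r0 : R).
Hypothesis hU : tiny_ball kappa x0 r0.
Hypothesis hX : locally_geodesically_complete X.
Implicit Types (x y z : X) (s t : R).

(** The added direction is that of [gx], towards [x], with opposite [gb], towards [b]; the given
    tuple and its opposite are kept. *)
Lemma strainer_extension x (k : nat) (delta : R) (p : 'I_k -> X) :
  mdist x0 x < r0 -> 0 < delta ->
  (forall i, closed_mball x0 (5 * r0) (p i) /\ p i <> x) ->
  exists2 e : R, 0 < e & forall y, 0 < mdist x y < e -> strainer_at x0 r0 delta p y ->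
    (forall i, `|mdist (p i) x - mdist (p i) y| <= e * mdist x y) ->
    strained k.+1 (12 * delta) y.
Proof.
move=> hx delta0 hp; have r00 := tiny_radius_gt0 hU.
have xp i : 0 < mdist x (p i) by rewrite mdist_gt0; apply/eqP => e; have [_] := hp i; apply.
have [rho1 rho10 hrho1] := ord_lower_bound xp.
pose rho := Num.min (rho1 / 2) (r0 / 2).
have rho0 : 0 < rho by rewrite lt_min !divr_gt0.
have [d d0 usc] := angle_usc_uniform hU (ltW hx) rho0 delta0.
pose e1 := Num.min delta 1.
have e10 : 0 < e1 by rewrite lt_min delta0 ltr01.
have e1d : e1 <= delta by rewrite ge_min lexx.
have e11 : e1 <= 1 by rewrite ge_min lexx orbT.
have c1 : 0 < 1 - cos e1.
  rewrite subr_gt0 -cos0 ltr_cos ?in_itv//= ?lexx ?pi_ge0//.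
  by have := @pi_ge2 R; lra.
(* [d] serves semicontinuity, [rho / 2] keeps [y] away from the [p i], [(1 - cos e1) / 2] turns a
   cosine above [- e] into an angle below [pi / 2 + e1], and [r0 / 4] keeps the construction inside
   the ball. *)
pose e := Num.min (Num.min d (rho / 2)) (Num.min ((1 - cos e1) / 2) (r0 / 4)).
have e0 : 0 < e by rewrite !lt_min d0 !divr_gt0.
have [[ed er] [ec er0]] : (e <= d /\ e <= rho / 2) /\ (e <= (1 - cos e1) / 2 /\ e <= r0 / 4).
  by rewrite /e !ge_min !lexx !orbT.
have rho_r : rho <= r0 / 2 by rewrite ge_min lexx orbT.
have rho_p i : rho <= mdist x (p i) / 2.
  have h : rho <= rho1 / 2 by rewrite ge_min lexx.
  by have := hrho1 i; lra.
exists e => // y /andP[D0 De] [_ [v [hv [vb [sph tup]]]]] hF.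
clearbody e rho.
have xy : x <> y by move=> exy; move: D0; rewrite exy mdistxx ltxx.
have yx : y <> x by move=> eyx; apply: xy.
have tri0 := metric_triangle x0 x y.
have yxD : mdist y x = mdist x y by exact: metric_sym.
have len z (g' : geodesic_from z) : mdist z (g' (geo_len g')) = geo_len g'.
  by apply: mdist_geo; rewrite lexx ltW// geo_len_gt0.
have almost_right (a : R) : 0 <= a <= pi -> - e <= cos a -> a < pi / 2 + e1.
  move=> ha ca; apply: ltr_of_cos_gap => //; first by rewrite divr_ge0// pi_ge0.
  by rewrite cos_pihalf; lra.
have to z q : mdist x0 z + mdist z q <= 10 * r0 -> q <> z ->
    exists g : geodesic_from z, geo_len g = mdist z q /\ g (geo_len g) = q.
  exact: (geodesic_to hU).
have [gx [lgx gxx]] := to y x ltac:(lra) xy.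
have [xy' [lxy xyy]] := to x y ltac:(lra) yx.
have [||b xb yb] := @extension_point _ _ _ _ _ hU hX x y (mdist x y + r0) xy.
- by lra_from hU hX r00.
- by lra_from hU hX hx De er0 r00.
have ybr : mdist y b = r0 by lra.
have by_ne : b <> y by move=> eb; move: ybr r00; rewrite eb mdistxx => <-; rewrite ltxx.
have bx_ne : b <> x by move=> eb; move: xb; rewrite eb mdistxx; lra_from hU hX D0 r00.
have [gb [lgb gbb]] := to y b ltac:(lra_from hU hX tri0 hx De er0 r00 ybr) by_ne.
have [bx [lbx bxb]] := to x b ltac:(lra_from hU hX xb hx De er0 r00) bx_ne.
have germ : angle xy' bx = 0.
  by apply: (angle_eq0 hU); rewrite ?bxb ?xyy ?lbx ?lxy ?ybr ?xb//;
    lra_from hU hX hx De er0 r00.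
(* Since [y] lies between [x] and [b], points at distance [t] from [y] on its two sides are [2 * t]
   apart. *)
have straight : angle gx gb = pi.
  apply: (@angle_opposite _ _ _ _ _ (Num.min (mdist x y) r0)); first by rewrite lt_min D0.
  move=> t; rewrite lt_min => /andP[t0 /andP[t1 t2]].
  have yt : mdist y (gx t) = t by apply: mdist_geo; lra_from hU hX t0 t1 lgx yxD.
  have yt' : mdist y (gb t) = t by apply: mdist_geo; lra_from hU hX t0 t2 lgb ybr.
  have xt : mdist x (gx t) = mdist x y - t.
    by rewrite -{1}gxx metric_sym geo_dist;
      [rewrite distrC ger0_norm| |]; lra_from hU hX lgx yxD t0 t1.
  have bt : mdist (gb t) b = r0 - t.
    by rewrite -gbb geo_dist;
      [rewrite distrC ger0_norm| |]; lra_from hU hX lgb ybr t0 t2.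
  have := metric_triangle (gx t) y (gb t); rewrite (metric_sym (gx t) y) yt yt'.
  have := metric_triangle x (gx t) b; have := metric_triangle (gx t) (gb t) b.
  by rewrite xt bt xb; lra_from hU hX.
have var_y (w : geodesic_from y) : mdist x0 y + geo_len w <= 10 * r0 ->
    geo_len w - mdist x (w (geo_len w)) <= mdist x y * cos (angle gx w).
  move=> bw; have lw := geo_len_gt0 w.
  have := first_variation_le hU (g := gx) (h := w) (t := geo_len gx) (s := geo_len w).
  by rewrite gxx lgx yxD; apply; lra_from hU hX tri0 hx De er0 r00 bw D0 lw.
have var_x (w : geodesic_from x) : mdist x0 x + geo_len w <= 10 * r0 ->
    geo_len w - mdist y (w (geo_len w)) <= mdist x y * cos (angle xy' w).
  move=> bw; have lw := geo_len_gt0 w.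
  have := first_variation_le hU (g := xy') (h := w) (t := geo_len xy') (s := geo_len w).
  by rewrite xyy lxy; apply; lra_from hU hX hx De er0 r00 bw D0 lw.
(* Extending [xy] to [b], which is far from [y], is what allows semicontinuity to
   bound the angles with the direction opposite to [x]. *)
have beyond (w : geodesic_from y) : rho <= geo_len w -> geo_len w <= 7 * r0 ->
    exists2 wx : geodesic_from x, w (geo_len w) = wx (geo_len wx) /\ geo_len wx <= 8 * r0 &
    angle w gb < angle xy' wx + delta.
  move=> w1 w2; have tri1 := metric_triangle y x (w (geo_len w)).
  have tri2 := metric_triangle x y (w (geo_len w)); rewrite !len yxD in tri1 tri2.
  have [||wx [lwx wxw]] := to x (w (geo_len w)).
  - by lra_from hU hX hx tri2 w2 De er0 r00.
  - by move=> ew; move: tri1; rewrite ew mdistxx; lra_from hU hX w1 De er rho0.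
  exists wx; first by rewrite wxw; split => //; lra_from hU hX lwx tri2 w2 De er0 r00.
  have : angle w gb < angle wx bx + delta.
    by apply: (usc y); rewrite ?wxw ?gbb ?bxb ?lwx ?lbx ?lgb ?ybr ?xb//;
      lra_from hU hX De ed w1 rho_r r00 tri2 w2 er0 D0.
  by have := angle_triangle wx xy' bx; rewrite germ (angle_sym wx xy'); lra_from hU hX.
(* The left sides of [var_y] and [var_x] for the common endpoint of [w] and [wx] cancel, so the
   angles at [y] and [x] have cosines of nonnegative sum, hence add up to at most [pi]. *)
have opp (w : geodesic_from y) : geo_len w = r0 -> angle gx w + angle w gb < pi + delta.
  move=> lw; have [||wx [wz lwx] h] := beyond w.
  - by lra_from hU hX lw rho_r r00.
  - by lra_from hU hX lw r00.
  suff : angle gx w + angle xy' wx <= pi by lra_from hU hX h.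
  apply: leD_pi_of_cos; [exact: angle_itv|exact: angle_itv|].
  have h1 := var_y w ltac:(lra_from hU hX tri0 hx De er0 lw r00).
  have h2 := var_x wx ltac:(lra_from hU hX lwx hx r00).
  rewrite wz len in h1; rewrite -wz len in h2.
  by rewrite -(pmulr_rge0 _ D0); lra_from hU hX h1 h2.
have /choice[g hg] : forall i, exists g : geodesic_from y,
    [/\ geo_len g = mdist y (p i), g (geo_len g) = p i & v i = dir_of g].
  by move=> i; have [g [lg gp vg]] := hv i; exists g; split => //; rewrite lg.
have lgp i : geo_len (g i) = mdist y (p i) by have [] := hg i.
have gp i : g i (geo_len (g i)) = p i by have [] := hg i.
have vg i : v i = dir_of (g i) by have [] := hg i.
have p5 i : mdist x0 (p i) <= 5 * r0 by have [] := hp i.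
have hFi i : `|mdist x (p i) - mdist y (p i)| <= e * mdist x y.
  by have := hF i; rewrite (metric_sym (p i) x) (metric_sym (p i) y).
have yp6 i : mdist y (p i) <= 7 * r0.
  by have := metric_triangle y x0 (p i); rewrite (metric_sym y x0); have := p5 i;
    lra_from hU hX tri0 hx De er0 r00.
have yp_rho i : rho <= mdist y (p i).
  by have := metric_triangle x y (p i); have := rho_p i; lra_from hU hX De er rho0.
have angle_px i : angle (g i) gx < pi / 2 + e1.
  rewrite angle_sym; apply: almost_right; first exact: angle_itv.
  have := var_y (g i); rewrite gp lgp => /(_ 
    ltac:(have := yp6 i; lra_from hU hX tri0 hx De er0 r00)) h.
  have := hFi i; rewrite ler_norml => /andP[h1 h2].
  by rewrite -(ler_pM2l D0); lra_from hU hX h h1 h2.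
have angle_pb i : angle (g i) gb < pi / 2 + e1 + delta.
  have [||wx [wz lwx] h] := beyond (g i); rewrite ?lgp//.
  suff : angle xy' wx < pi / 2 + e1 by lra_from hU hX h.
  apply: almost_right; first exact: angle_itv.
  have h3 := var_x wx ltac:(lra_from hU hX lwx hx r00); rewrite -wz gp -(len x wx) -wz gp in h3.
  have := hFi i; rewrite ler_norml => /andP[h1 h2].
  by rewrite -(ler_pM2l D0); lra_from hU hX h1 h2 h3.
have angle_sum i : pi <= angle (g i) gx + angle (g i) gb.
  by rewrite -straight (angle_sym (g i) gx); exact: angle_triangle.
(* An upper bound for [vb i] requires a lower bound for the angle between [g i] and [gx];
   [angle_sum] and [angle_pb] give [pi / 2 - e1 - delta]. *)
have vbx i : dir_dist (vb i) (dir_of gx) < pi / 2 + 12 * delta.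
  have := sph i (dir_of gx); rewrite vg dir_dist_dir_of (dir_distC (dir_of gx)).
  by have := angle_sum i; have := angle_pb i; lra_from hU hX e1d delta0.
have vbb i : dir_dist (vb i) (dir_of gb) < pi / 2 + 12 * delta.
  have := sph i (dir_of gb); rewrite vg dir_dist_dir_of (dir_distC (dir_of gb)).
  by have := angle_sum i; have := angle_px i; lra_from hU hX e1d delta0.
have d12 (a : R) : a + delta <= a + 12 * delta by lra_from hU hX delta0.
have angle_px12 i : angle (g i) gx < pi / 2 + 12 * delta.
  by have := angle_px i; lra_from hU hX e1d delta0.
have angle_pb12 i : angle (g i) gb < pi / 2 + 12 * delta.
  by have := angle_pb i; lra_from hU hX e1d delta0.
pose V (i : 'I_k.+1) := if unlift ord0 i is Some j then v j else dir_of gx.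
pose Vb (i : 'I_k.+1) := if unlift ord0 i is Some j then vb j else dir_of gb.
exists V, Vb; split.
  move=> i w; rewrite /V /Vb; case: (unliftP ord0 i) => [j _|_].
    exact: lt_le_trans (sph j w) (d12 _).
  have hy2 : mdist x0 y <= 2 * r0 by lra_from hU hX tri0 hx De er0 r00.
  have [w' lw ww'] := direction_of_geodesic hU hX w hy2.
  rewrite (dir_distC w) !(dir_dist_eq0 _ ww') (dir_distC (dir_of gb)) !dir_dist_dir_of.
  exact: lt_le_trans (opp w' lw) (d12 _).
move=> i j; rewrite /V /Vb; case: (unliftP ord0 i) => [i' ->|->]; case: (unliftP ord0 j) => [j' ->|->].
- rewrite (inj_eq lift_inj) => /tup[u1 u2 u3].
  by split; [exact: lt_le_trans u1 (d12 _)|exact: lt_le_trans u2 (d12 _)|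
             exact: lt_le_trans u3 (d12 _)].
- by move=> _; rewrite vg !dir_dist_dir_of.
- by move=> _; rewrite vg !dir_dist_dir_of !(dir_distC (dir_of _) (vb j')) (angle_sym gx).
- by rewrite eqxx.
Qed.

End strainer_maps.

(** * Strainer coordinates and the countable family of compact sets *)

Section euclidean_distance.
Context {R : realType} {X : metricType R}.

Lemma closed_of_approx (A : set X) :
  (forall x, (forall e : R, 0 < e -> exists2 y, A y & mdist x y < e) -> A x) -> closed A.
Proof.
move=> h x cx; apply: h => e e0.
by have [y [Ay]] := cx (ball x e) (nbhsx_ballx x e e0); rewrite ballEmdist; exists y.
Qed.

Lemma coord_le_eucl_dist k (p : 'I_k -> X) x y i :
  `|mdist (p i) x - mdist (p i) y| <= eucl_dist (dist_map p x) (dist_map p y).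
Proof.
rewrite -sqrtr_sqr ler_sqrt ?sumr_ge0//; last by move=> j _; rewrite -expr2 sqr_ge0.
rewrite /dot (bigD1 i)//= !mxE expr2 lerDl sumr_ge0// => j _.
by rewrite -expr2 sqr_ge0.
Qed.

Lemma eucl_dist_le k (p : 'I_k -> X) x y :
  eucl_dist (dist_map p x) (dist_map p y) <= k.+1%:R * mdist x y.
Proof.
have d0 : 0 <= k.+1%:R * mdist x y by rewrite mulr_ge0 ?mdist_ge0.
rewrite -[leRHS]ger0_norm// -sqrtr_sqr ler_sqrt ?sqr_ge0//.
apply: (@le_trans _ _ (\sum_(i < k) mdist x y ^+ 2)).
  apply: ler_sum => i _; rewrite !mxE -expr2 -[_ ^+ 2]real_normK ?num_real//.
  rewrite ler_pXn2r ?nnegrE ?mdist_ge0 ?normr_ge0// (metric_sym (p i) x) (metric_sym (p i) y).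
  exact: mdist_lip.
rewrite sumr_const card_ord -[leLHS]mulr_natl exprMn ler_wpM2r ?sqr_ge0//.
by rewrite -natrX ler_nat (leq_trans (leqnSn k))// -{1}(expn1 k.+1) leq_pexp2l.
Qed.

End euclidean_distance.

Lemma inv_nat_lt {R : realType} (e : R) : 0 < e -> exists n : nat, n.+1%:R^-1 < e.
Proof.
move=> e0; exists (Num.bound e^-1); rewrite invf_plt ?posrE//.
apply: lt_trans (_ : (Num.bound e^-1)%:R < _); last by rewrite ltr_nat.
by have := archi_boundP (ltW (_ : 0 < e^-1)); apply; rewrite invr_gt0.
Qed.

Theorem theorem1p9 (R : realType) (X : metricType R) (hX : GCBA X)
    (kappa : R) (hkappa : curvature_le X kappa)
    (x0 : X) (r0 : R) (hU : tiny_ball kappa x0 r0)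
    (k : nat) (delta : R) (hdelta : 0 < delta)
    (V : set X) (hV : open V) (hVU : V `<=` ball x0 r0)
    (F : X -> 'rV[R]_k) (hF : strainer_map x0 r0 delta V F) :
  exists K : nat -> set X,
    [/\ forall i, compact (K i),
        V `\` strained k.+1 (12 * delta) = \bigcup_i K i
      & forall i, bilipschitz_on (K i) F].
Proof.
have [[D cD dD] _ gc _] := hX; have r00 := tiny_radius_gt0 hU.
have [p [p5 Fp sp]] := hF.
have Vr x : V x -> mdist x0 x < r0 by move=> /hVU; rewrite ballEmdist.
have /countable_injP[f finj] := cD.
(* An enumeration of the dense set [D], with default value [x0]. *)
pose g n := xget x0 [set z | D z /\ f z = n].
have gf z : D z -> g (f z) = z.
  move=> Dz; have [Dg fg] := @xgetPex _ x0 [set z' | D z' /\ f z' = f z] (ex_intro _ z (conj Dz erefl)).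
  by apply: finj; rewrite ?inE.
pose S := V `\` strained k.+1 (12 * delta).
pose c (m : nat) : R := m.+1%:R^-1.
have c0 m : 0 < c m by rewrite invr_gt0.
(* The inequality is required against all [y] in [S], so a fixed [y] can be tested along points
   converging to [x]; this makes the condition pass to limits. *)
pose Sm m := [set x | S x /\ forall y, S y -> y <> x -> mdist x y < c m ->
  exists i, c m * mdist x y <= `|mdist (p i) x - mdist (p i) y|].
(* Closed sets exhausting [V]: limits of points of [C j] stay in [V]. *)
pose C j := [set x | mdist x0 x <= r0 /\ forall z, ~ V z -> c j <= mdist x z].
(* With radius [c m / 4] any two points of the piece are closer than [c m], so the inequality of
   [Sm m] applies to them. *)
pose K' (mjl : nat * nat * nat) :=
  Sm mjl.1.1 `&` C mjl.1.2 `&` closed_mball (g mjl.2) (c mjl.1.1 / 4).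
have cK' mjl : compact (K' mjl).
  case: mjl => [[m j] l]; rewrite /K' /=; have cW : compact (closed_mball x0 (10 * r0)) by case: hU.
  apply: (subclosed_compact _ cW); last first.
    by move=> x [[_ [xr _]] _]; rewrite /closed_mball/=; lra.
  apply: closed_of_approx => x hx.
  have Cx : C j x.
    split; first apply/ler_addgt0Pr => e e0; last move=> z Vz; last apply/ler_addgt0Pr => e e0.
      have [y [[_ [yr _]] _] xy] := hx e e0.
      by have := metric_triangle x0 y x; rewrite (metric_sym y x); lra.
    have [y [[_ [_ yV]] _] xy] := hx e e0.
    by have := yV z Vz; have := metric_triangle y x z; rewrite (metric_sym y x) /=; lra.
  have Vx : V x.
    by apply: contrapT => nVx; have := Cx.2 x nVx; rewrite mdistxx leNgt c0.
  have Sx : S x.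
    split => // sx; have [d d0 hd] := strained_open hU gc (Vr x Vx) sx.
    by have [y [[[[_ nsy] _] _] _] xy] := hx d d0; apply: nsy; exact: hd.
  split; last first.
    rewrite /closed_mball/=; apply/ler_addgt0Pr => e e0.
    have [y [_ yl] xy] := hx e e0; move: yl; rewrite /closed_mball/= => yl.
    by have := metric_triangle (g l) y x; rewrite (metric_sym y x); lra.
  split=> //; split=> // y Sy yx xyc; apply: contrapT => noi.
  have xy0 : 0 < mdist x y by rewrite mdist_gt0; apply/eqP => e; apply: yx.
  have gap i : 0 < c m * mdist x y - `|mdist (p i) x - mdist (p i) y|.
    by rewrite subr_gt0 ltNge; apply/negP => le; apply: noi; exists i.
  have [n n0 hn] := ord_lower_bound gap.
  (* If every coordinate at [x] falls short by at least [n], then moving [x] by [e] changes the two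
     sides by at most [2 * e < n] in all. The other bounds keep [z] within [c m] of [y] and
     different from [y]. *)
  pose e := Num.min (n / 4) (Num.min ((c m - mdist x y) / 2) (mdist x y / 2)).
  have e0 : 0 < e by rewrite !lt_min !divr_gt0// subr_gt0.
  have e1 : e <= n / 4 by rewrite ge_min lexx.
  have e2 : e <= (c m - mdist x y) / 2 by rewrite !ge_min lexx orbT.
  have e3 : e <= mdist x y / 2 by rewrite !ge_min lexx !orbT.
  clearbody e.
  have [z [[[Sz hz] _] _] xz] := hx e e0.
  have tri1 := metric_triangle z x y; have tri2 := metric_triangle x z y.
  rewrite (metric_sym z x) in tri1.
  have yz : y <> z by move=> yz; move: xz; rewrite -yz; lra.
  have [|i hi] := hz y Sy yz; first by rewrite /=; lra.
  have := hn i; move: hi => /=.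
  have := ler_normD (mdist (p i) z - mdist (p i) x) (mdist (p i) x - mdist (p i) y).
  rewrite addrA subrK.
  have := mdist_lip z x (p i); rewrite !(metric_sym _ (p i)) (metric_sym z x).
  have cm1 : c m <= 1 by rewrite invf_le1// ler1n.
  have : c m * (mdist x y - e) <= c m * mdist z y by rewrite ler_wpM2l ?(ltW (c0 m))//; lra.
  have : c m * e <= e by rewrite ler_piMl// ltW.
  by lra.
have bK' mjl : bilipschitz_on (K' mjl) F.
  case: mjl => [[m j] l]; rewrite /K' /=; exists (m.+1%:R + k.+1%:R); first by rewrite addr_gt0.
  move=> x y [[[Sx hx] _] xl] [[[Sy _] _] yl].
  rewrite (Fp x Sx.1) (Fp y Sy.1); apply/andP; split; last first.
    apply: le_trans (eucl_dist_le p x y) _.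
    by rewrite ler_wpM2r ?mdist_ge0// lerDr.
  have [->|xy] := eqVneq x y; first by rewrite mdistxx mulr0 sqrtr_ge0.
  move: xl yl; rewrite /closed_mball/= => xl yl.
  have xyc : mdist x y < c m.
    by have := metric_triangle x (g l) y; rewrite (metric_sym x (g l)); have := c0 m; lra.
  have [|i hi] := hx y Sy _ xyc; first by move=> e; move: xy; rewrite e eqxx.
  apply: le_trans (le_trans hi (coord_le_eucl_dist p x y i)).
  rewrite ler_wpM2r ?mdist_ge0// /c lef_pV2 ?posrE ?addr_gt0//.
  by rewrite lerDl.
exists (fun n => if @unpickle (nat * nat * nat)%type n is Some mjl then K' mjl else set0).
split.
- by move=> n; case: unpickle => // ; exact: compact0.
- apply/seteqP; split => [x Sx|x [n _]]; last by case: unpickle => // mjl [[[]]].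
  have Vx := Sx.1.
  have [e e0 he] := strainer_extension hU gc (Vr x Vx) hdelta (sp x Vx).1.
  have [m hm] := inv_nat_lt e0.
  have [d /= d0 hd] := (nbhs_ballP _ _).1 (open_nbhs_nbhs (conj hV Vx)).
  have [j hj] := inv_nat_lt d0.
  have cm4 : 0 < c m / 4 by rewrite divr_gt0.
  have [z [/interior_subset xz Dz]] : interior (ball x (c m / 4)) `&` D !=set0.
    by apply: dD; [exists x; exact: nbhsx_ballx|exact: open_interior].
  exists (pickle (m, j, f z)) => //; rewrite /= pickleK; split; last first.
    rewrite /closed_mball/= gf// metric_sym ltW//.
    by move: xz; rewrite ballEmdist.
  split; last first.
    split; first exact: ltW (Vr x Vx).
    move=> z' nVz; rewrite leNgt; apply/negP => xz'; apply: nVz; apply: hd.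
    by rewrite ballEmdist/=; exact: lt_trans hj.
  (* If every coordinate varied by less than [c m * mdist x y], then [y] would be strained by the
     choice of [e]; [c m < e] serves as radius and as ratio. *)
  split=> // y Sy yx xy; apply: contrapT => noi.
  have xy0 : 0 < mdist x y by rewrite mdist_gt0; apply/eqP => exy; apply: yx.
  case: Sy => Vy; apply; apply: he => //; first by rewrite xy0; exact: lt_trans hm.
    exact: sp.
  move=> i; rewrite leNgt; apply/negP => lti; apply: noi; exists i.
  by apply: le_trans (ltW lti); rewrite ler_wpM2r ?mdist_ge0// ltW.
- move=> n; case: unpickle => // ; by exists 1.
Qed.
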